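(* Let $F$ be a totally real number field with adele ring $\mathbb{A}$, let $\omega$ be a unitary Hecke character of $\mathbb{A}^\times/F^\times$, and let $\varphi\in\mathcal{S}(\mathbb{A}^2)$ be a Schwartz-Bruhat function. Then for every $\gamma\in\mathrm{GL}_2(F)$ and every $g\in\mathrm{GL}_2(\mathbb{A})$, $$E^{\rm ana}_{\omega,s}(\varphi)(\gamma g)=E^{\rm ana}_{\omega,s}(\varphi)(g),$$ as an identity between meromorphic functions of $s$.
   Context: $|\cdot|$ is the idelic norm. $\mathcal{S}(\mathbb{A}^2)$ is the space of complex-valued Schwartz-Bruhat functions on $\mathbb{A}^2$ (column vectors). For $\Re(s)>1$, $$E^{\rm ana}_{\omega,s}(\varphi)(g)=|\det g|^{-s}\int_{\mathbb{A}^\times/F^\times}\omega(t)|t|^{2s}\,\Theta(\varphi)(t^{-1}g)\,d^\times t,\qquad \Theta(\varphi)(g)=\sum_{v\in F^2\setminus\{0\}}\varphi(g^{-1}v),$$ where an idele $t$ is identified with the scalar matrix $t\cdot 1_2$; this converges absolutely for $\Re(s)>1$, and for other $s$ the notation denotes the meromorphic continuation to $\mathbb{C}$ (which exists). $d^\times t$ is a fixed Haar measure on $\mathbb{A}^\times$, with the quotient measure on $\mathbb{A}^\times/F^\times$. *)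

(* Defs.v *)
From HB Require Import structures.
From mathcomp Require Import all_boot all_order all_algebra all_field.
From mathcomp Require Import finmap generic_quotient complex.
From mathcomp Require Import all_classical all_reals all_analysis.
From mathcomp Require Import measurable_realfun zify.
Set Implicit Arguments.
Unset Strict Implicit.
Unset Printing Implicit Defensive.
Import Order.TTheory GRing.Theory Num.Theory.
Import numFieldNormedType.Exports.
Local Open Scope classical_set_scope.
Local Open Scope ring_scope.
Local Open Scope complex_scope.
Local Open Scope quotient_scope.

(* Normalized discrete valuations, with the convention v(0) = 0 instead of
   +oo, so that a valuation is determined by its values. Each nonarchimedean
   place of a number field contains exactly one of them; "dvaluation F" is the
   type of finite places of F. *)
Record dvaluation (K : fieldType) := DValuation {
  dval :> K -> int;
  dval0 : dval 0 = 0;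
  dvalM : forall x y, x != 0 -> y != 0 -> dval (x * y) = dval x + dval y;
  dvalD : forall x y, x != 0 -> y != 0 -> x + y != 0 ->
    Num.min (dval x) (dval y) <= dval (x + y);
  dval_onto : exists2 x, x != 0 & dval x = 1 }.

HB.instance Definition _ (K : fieldType) := gen_eqMixin (dvaluation K).
HB.instance Definition _ (K : fieldType) := gen_choiceMixin (dvaluation K).

(* v(x) >= n, where v(0) = +oo. *)
Definition vge (K : fieldType) (v : dvaluation K) (n : int) (x : K) : Prop :=
  x = 0 \/ n <= v x.

Section Valuation.
Variables (K : fieldType) (v : dvaluation K).
Implicit Types (x y : K) (m n : int).

Lemma dval1 : v 1 = 0.
Proof.
have := dvalM v (oner_neq0 K) (oner_neq0 K); rewrite mulr1 => h.
by apply: (addrI (v 1)); rewrite -h addr0.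
Qed.

Lemma dvalN x : v (- x) = v x.
Proof.
have N1 : (-1 : K) != 0 by rewrite oppr_eq0 oner_neq0.
have vN1 : v (-1) = 0.
  have := dvalM v N1 N1; rewrite mulrNN mulr1 dval1 => /esym/eqP.
  by rewrite -mulr2n mulrn_eq0 /= => /eqP.
have [->|x0] := eqVneq x 0; first by rewrite oppr0.
by rewrite -mulN1r dvalM// vN1 add0r.
Qed.

Lemma dvalV x : x != 0 -> v x^-1 = - v x.
Proof.
move=> x0; have xV0 : x^-1 != 0 by rewrite invr_eq0.
have := dvalM v x0 xV0; rewrite divff// dval1 => /esym/eqP.
by rewrite addrC addr_eq0 => /eqP.
Qed.

Lemma dvalX x n : x != 0 -> v (x ^ n) = n * v x.
Proof.
move=> x0.
have h (k : nat) : v (x ^+ k) = k%:Z * v x.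
  elim: k => [|k ih]; first by rewrite expr0 dval1 mul0r.
  by rewrite exprS dvalM ?expf_neq0// ih intS mulrDl mul1r.
case: n => k; first exact: h.
by rewrite NegzE -exprnN dvalV ?expf_neq0// h mulNr.
Qed.

Lemma vge_val n x : x != 0 -> vge v n x -> n <= v x.
Proof. by move=> x0 []// /eqP; rewrite (negbTE x0). Qed.

Lemma vge0 n : vge v n 0. Proof. by left. Qed.

Lemma vgeD n x y : vge v n x -> vge v n y -> vge v n (x + y).
Proof.
move=> [->|nx] hy; first by rewrite add0r.
case: hy => [->|ny]; first by rewrite addr0; right.
have [->|x0] := eqVneq x 0; first by rewrite add0r; right.
have [->|y0] := eqVneq y 0; first by rewrite addr0; right.
have [->|xy0] := eqVneq (x + y) 0; first by left.
by right; apply: le_trans (dvalD v x0 y0 xy0); rewrite le_min nx.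
Qed.

Lemma vgeN n x : vge v n x -> vge v n (- x).
Proof. by move=> [->|nx]; [rewrite oppr0; left|right; rewrite dvalN]. Qed.

Lemma vgeM n m x y : vge v n x -> vge v m y -> vge v (n + m) (x * y).
Proof.
move=> [->|nx] hy; first by rewrite mul0r; left.
case: hy => [->|my]; first by rewrite mulr0; left.
have [->|x0] := eqVneq x 0; first by rewrite mul0r; left.
have [->|y0] := eqVneq y 0; first by rewrite mulr0; left.
by right; rewrite dvalM// lerD.
Qed.

Lemma vgeW n m x : m <= n -> vge v n x -> vge v m x.
Proof. by move=> mn [->|nx]; [left|right; exact: le_trans nx]. Qed.

Lemma vge_sum (I : Type) (r : seq I) (P : pred I) n (f : I -> K) :
  (forall i, P i -> vge v n (f i)) -> vge v n (\sum_(i <- r | P i) f i).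
Proof. by move=> h; apply: big_ind => //; [exact: vge0|exact: vgeD]. Qed.

Lemma vge_nat (k : nat) : vge v 0 k%:R.
Proof.
elim: k => [|k ih]; first exact: vge0.
by rewrite -natr1; apply: vgeD => //; right; rewrite dval1.
Qed.

Lemma vge_int n : vge v 0 n%:~R.
Proof.
case: n => n; first exact: vge_nat.
by rewrite NegzE rmorphN; apply: vgeN; exact: vge_nat.
Qed.

Lemma dvalD_lt x y : x != 0 -> vge v (v x + 1) y ->
  x + y != 0 /\ v (x + y) = v x.
Proof.
move=> x0 hy.
have xy0 : x + y != 0.
  apply/eqP => /eqP; rewrite addrC addr_eq0 => /eqP yE.
  move: hy; rewrite yE => /vgeN; rewrite opprK => /(vge_val x0).
  by rewrite gerDl.
split=> //; apply/eqP; rewrite eq_le; apply/andP; split; last first.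
  apply: vge_val => //; apply: vgeD; first by right.
  by apply: vgeW hy; rewrite lerDl.
rewrite leNgt; apply/negP => lt.
have : vge v (v x + 1) (x + y - y).
  by apply: vgeD; [right; rewrite lezD1|exact: vgeN].
by rewrite addrK => /(vge_val x0); rewrite gerDl.
Qed.

End Valuation.

Section FinitePlaces.
Variable F : fieldExtType rat.
Implicit Types (v w : dvaluation F) (x y : F).

Lemma dval_inj v w : dval v = dval w -> v = w.
Proof.
case: v w => [v v0 vM vD vo] [w w0 wM wD wo] /= vw; subst w.
by congr DValuation; exact: Prop_irrelevance.
Qed.

Lemma intF_neq0 (n : int) : n != 0 -> n%:~R != 0 :> F.
Proof.
move=> n0; have -> : n%:~R = (n%:~R : rat)%:A :> F by rewrite scaler_int.
by rewrite scaler_eq0 oner_eq0 orbF intr_eq0.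
Qed.

Lemma dval_sep v w : v <> w -> exists x, [/\ x != 0, 0 <= v x & w x < 0].
Proof.
move=> vw; apply: contrapT => /forallNP h; apply: vw.
have vw0 x : x != 0 -> 0 <= v x -> 0 <= w x.
  by move=> x0 vx; rewrite leNgt; apply/negP => wx; apply: (h x).
have [p p0 vp] := dval_onto v; have [y y0 wy] := dval_onto w.
have wE x : x != 0 -> w x = v x * w p.
  move=> x0; pose u := x * p ^ (- v x).
  have u0 : u != 0 by rewrite mulf_neq0// expfz_neq0.
  have vu : v u = 0 by rewrite dvalM ?expfz_neq0// dvalX// vp mulr1 subrr.
  have wu : w u = 0.
    apply/eqP; rewrite eq_le vw0 ?vu// andbT -oppr_ge0 -dvalV//.
    by apply: vw0; rewrite ?invr_eq0// dvalV// vu.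
  have := wu; rewrite dvalM ?expfz_neq0// dvalX// => /eqP.
  by rewrite addr_eq0 mulNr opprK => /eqP.
have wp : w p = 1.
  have := wE y y0; rewrite wy => e.
  have := vw0 p p0; rewrite vp => /(_ isT); move: e; case: (w p) => // n e _.
  have := congr1 absz e; rewrite abszM /= => /esym/eqP.
  by rewrite muln_eq1 => /andP[_ /eqP ->].
apply: dval_inj; apply/funext => x.
have [->|x0] := eqVneq x 0; first by rewrite !dval0.
by rewrite (wE x x0) wp mulr1.
Qed.

Lemma dval_sep_lt v w : v <> w -> exists x, [/\ x != 0, v x < 0 & 0 < w x].
Proof.
move=> vw; have [x [x0 vx wx]] := dval_sep vw.
have [|y [y0 wy vy]] := @dval_sep w v; first by move=> e; apply: vw.
exists (y / x); split; first by rewrite mulf_neq0// invr_eq0.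
- by rewrite dvalM ?invr_eq0// dvalV// subr_lt0 (lt_le_trans vy).
- by rewrite dvalM ?invr_eq0// dvalV// subr_gt0 (lt_le_trans wx).
Qed.

Lemma large_exp (ws : seq (dvaluation F)) x y :
  (forall w, w \in ws -> 0 < w x) ->
  exists r : nat, forall s : nat, (r <= s)%N ->
    forall w, w \in ws -> 0 < s%:Z * w x + w y.
Proof.
elim: ws => [|w ws ih] h; first by exists 0%N.
have [|r hr] := ih; first by move=> w' iw; apply: h; rewrite inE iw orbT.
exists (maxn r (`|w y|.+1)); move=> s; rewrite geq_max => /andP[rs ws'] w'; rewrite inE => /predU1P[->|].
  have wx : 0 < w x by apply: h; rewrite inE eqxx.
  have : s%:Z * 1 <= s%:Z * w x by rewrite ler_wpM2l// -gtz0_ge1.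
  lia.
exact: hr.
Qed.

Lemma dval_approx v (ws : seq (dvaluation F)) : v \notin ws ->
  exists x, [/\ x != 0, v x < 0 & forall w, w \in ws -> 0 < w x].
Proof.
elim: ws => [|w ws ih].
  move=> _; have [p p0 vp] := dval_onto v; exists p^-1; split=> //.
    by rewrite invr_eq0.
  by rewrite dvalV// vp.
rewrite inE negb_or => /andP[/eqP vw /ih[z [z0 vz wsz]]].
have [y [y0 vy wy]] := dval_sep_lt vw.
have [wz|wz] := ltP 0 (w z).
  by exists z; split=> // w'; rewrite inE => /predU1P[->//|]; exact: wsz.
have [r hr] := large_exp y wsz.
pose s := r.+1; have {}hr := hr s (leqnSn r).
have zs0 : z ^ s%:Z != 0 by rewrite expfz_neq0.
move: wz; rewrite le_eqVlt => /orP[/eqP wz|wz].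
  exists (z ^ s%:Z * y); split; first by rewrite mulf_neq0.
  - rewrite dvalM// dvalX//; rewrite -(addr0 0) ltrD// pmulr_rlt0//.
  - move=> w'; rewrite inE => /predU1P[->|iw]; first by rewrite dvalM// dvalX// wz mulr0 add0r.
    by rewrite dvalM// dvalX//; exact: hr.
have den (u : dvaluation F) : u z < 0 ->
    1 + z ^ s%:Z != 0 /\ u (1 + z ^ s%:Z) = u (z ^ s%:Z).
  move=> uz; rewrite addrC; apply: dvalD_lt => //; right; rewrite dval1.
  by rewrite -ltzD1 ltrD2r dvalX// pmulr_rlt0.
have [d0 vd] := den v vz; have [_ wd] := den w wz.
exists (z ^ s%:Z / (1 + z ^ s%:Z) * y).
have q0 : z ^ s%:Z / (1 + z ^ s%:Z) != 0 by rewrite mulf_neq0// invr_eq0.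
split; first by rewrite mulf_neq0.
- by rewrite dvalM// dvalM ?invr_eq0// dvalV// vd subrr add0r.
- move=> w'; rewrite inE => /predU1P[->|iw]; first by rewrite dvalM// dvalM ?invr_eq0// dvalV// wd subrr add0r.
  have [] // := @dvalD_lt _ w' 1 (z ^ s%:Z) (oner_neq0 F).
    right; rewrite dval1 add0r dvalX// -gtz0_ge1 pmulr_rgt0//; exact: wsz.
  rewrite dval1 => _ w'd.
  by rewrite dvalM// dvalM ?invr_eq0// dvalV// w'd subr0 dvalX//; exact: hr.
Qed.

Lemma dval_idem v (ws : seq (dvaluation F)) : v \notin ws ->
  exists x, [/\ x != 0, v x = 0 & forall w, w \in ws -> 0 < w x].
Proof.
move=> /dval_approx[z [z0 vz wz]].
have [d0 vd] : 1 + z != 0 /\ v (1 + z) = v z.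
  by rewrite addrC; apply: dvalD_lt => //; right; rewrite dval1 lezD1.
exists (z / (1 + z)); split; first by rewrite mulf_neq0// invr_eq0.
- by rewrite dvalM ?invr_eq0// dvalV// vd subrr.
- move=> w iw; have [] // := @dvalD_lt _ w 1 z (oner_neq0 F).
    by right; rewrite dval1 add0r -gtz0_ge1; exact: wz.
  by rewrite dval1 => _ wd; rewrite dvalM ?invr_eq0// dvalV// wd subr0; exact: wz.
Qed.

Section AbovePrime.
Variable p : nat.
Hypothesis p_prime : prime p.

Lemma dval_coprime v (a : int) : 0 < v p%:R -> ~~ (p %| `|a|)%N ->
  v a%:~R = 0.
Proof.
move=> vp pa; have a0 : a != 0 by apply: contra pa => /eqP ->; rewrite dvdn0.
apply/eqP; rewrite eq_le; apply/andP; split; last first.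
  by apply: vge_val (vge_int v a); exact: intF_neq0.
rewrite leNgt; apply/negP => va.
have := @Bezoutz p a => -[u [t ut]].
have cop : gcdz p a = 1.
  by rewrite /gcdz; have := prime_coprime `|a|%N p_prime; rewrite pa => /eqP ->.
have : vge v 1 (u%:~R * p%:R + t%:~R * a%:~R).
  apply: vgeD; rewrite -[1]add0r; apply: vgeM; try exact: vge_int.
    by right; rewrite -gtz0_ge1.
  by right; rewrite -gtz0_ge1.
rewrite -[p%:R]/(p%:Z%:~R) -!intrM -intrD ut cop => /(vge_val (oner_neq0 F)).
by rewrite dval1.
Qed.

Lemma dval_ratio v w (r : rat) : 0 < v p%:R -> 0 < w p%:R ->
  vge v 0 r%:A -> vge w 0 r%:A.
Proof.
move=> vp wp; have [->|r0] := eqVneq r 0; first by rewrite scale0r; left.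
have rE : r%:A = (numq r)%:~R / (denq r)%:~R :> F.
  by rewrite -[LHS]/(in_alg F r) -{1}[r]divq_num_den fmorph_div !rmorph_int.
have n0 : (numq r)%:~R != 0 :> F by rewrite intF_neq0// numq_eq0.
have d0 : (denq r)%:~R != 0 :> F by rewrite intF_neq0// denq_neq0.
have [pd|pd] := boolP (p %| `|denq r|)%N; last first.
  move=> _; right; rewrite rE dvalM ?invr_eq0// dvalV// (dval_coprime wp pd) subr0.
  exact: vge_val (vge_int w _).
have pn : ~~ (p %| `|numq r|)%N.
  apply/negP => pn; have := coprime_num_den r; rewrite /coprime => /eqP g.
  have : (p %| 1)%N by rewrite -g dvdn_gcd pn.
  by rewrite dvdn1 => /eqP p1; move: p_prime; rewrite p1.
have [m dE] : exists m : int, denq r = m * p.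
  have := pd; rewrite -[X in (X %| _)%N]/(`|p%:Z|%N) -dvdzE => /dvdzP[m ->].
  by exists m.
rewrite rE => /(vge_val _); rewrite mulf_neq0 ?invr_eq0// => /(_ isT).
rewrite dvalM ?invr_eq0// dvalV// (dval_coprime vp pn) sub0r oppr_ge0.
have m0 : m != 0.
  by apply/eqP => mz; move: (denq_neq0 r); rewrite dE mz mul0r eqxx.
have := vge_val (intF_neq0 m0) (vge_int v m) => vm.
rewrite dE intrM dvalM ?intF_neq0//; last by rewrite eqz_nat -lt0n prime_gt0.
by rewrite leNgt -[p%:~R]/(p%:R) (lt_le_trans vp)// lerDr.
Qed.

End AbovePrime.

Lemma finite_above_prime (p : nat) : prime p ->
  finite_set [set v : dvaluation F | 0 < v p%:R].
Proof.
move=> pp; apply: contrapT => /(infinite_set_fset (\dim {:F}).+1)[B BV sB].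
set s := finmap.enum_fset B in sB.
have us : uniq s by exact: finmap.fset_uniq.
have sp v : v \in s -> 0 < v p%:R by exact: BV.
have /choice[e he] v : exists x, [/\ x != 0, v x = 0 &
    forall w, w \in s -> w != v -> 0 < w x].
  have [|x [x0 vx wx]] := @dval_idem v [seq w <- s | w != v].
    by rewrite mem_filter eqxx.
  by exists x; split=> // w ws wv; apply: wx; rewrite mem_filter wv.
pose m := size s; pose pl (i : 'I_m) := tnth (in_tuple s) i.
have pls i : pl i \in s by exact: mem_tnth.
have plI i j : i != j -> pl i != pl j.
  apply: contra => /eqP; rewrite /pl !(tnth_nth (pl i)) /= => /eqP.
  by rewrite nth_uniq.
pose X := [tuple e (pl i) | i < m].
have : ~~ free X.
  rewrite /free size_tuple neq_ltn; apply/orP; left.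
  by apply: leq_ltn_trans sB; apply: dimvS; exact: subvf.
move=> /freeP /existsNP[k /not_implyP[kX /existsNP[i0 /eqP ki0]]].
pose v0 := pl i0.
case: (@arg_minP _ _ _ i0 (fun i => k i != 0) (fun i => v0 (k i)%:A) ki0).
move=> i ki imin; have [ei0 vei wei] := he (pl i).
have kA (j : 'I_m) : k j != 0 -> (k j)%:A != 0 :> F.
  by move=> kj; rewrite scaler_eq0 oner_eq0 orbF.
have : vge (pl i) 1 (\sum_(j < m | j != i) (k j / k i)%:A * e (pl j)).
  apply: vge_sum => j ji; have [ej0 vej wej] := he (pl j).
  rewrite -[1]add0r; apply: vgeM; last first.
    right; rewrite -gtz0_ge1; apply: wej => //; apply: plI.
    by rewrite eq_sym.
  apply: (@dval_ratio p pp v0); [exact: sp (pls i0)|exact: sp (pls i)|].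
  have [->|kj] := eqVneq (k j) 0; first by rewrite mul0r scale0r; left.
  have -> : (k j / k i)%:A = (k j)%:A / (k i)%:A :> F.
    by rewrite -[LHS]/(in_alg F _) fmorph_div.
  by right; rewrite dvalM ?invr_eq0 ?kA// dvalV ?kA// subr_ge0 imin.
have -> : \sum_(j < m | j != i) (k j / k i)%:A * e (pl j) = - e (pl i).
  move: kX; rewrite (bigD1 i)//= => /eqP; rewrite addr_eq0 => /eqP kX.
  apply: (scalerI ki); rewrite scalerN.
  rewrite (_ : e (pl i) = X`_i); last by rewrite -tnth_nth tnth_mktuple.
  rewrite kX opprK.
  rewrite scaler_sumr; apply: eq_bigr => j _.
  rewrite (_ : X`_j = e (pl j)); last by rewrite -tnth_nth tnth_mktuple.
  by rewrite -scalerAl mul1r scalerA mulrC divfK.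
by move=> /vgeN; rewrite opprK => /(vge_val ei0); rewrite vei.
Qed.

Lemma finite_above_int (a : int) : a != 0 ->
  finite_set [set v : dvaluation F | 0 < v a%:~R].
Proof.
move=> a0; have fin : finite_set (\bigcup_(p in [set` primes `|a|])
    [set v : dvaluation F | 0 < v p%:R]).
  apply: bigcup_finite; first exact: finite_seq.
  by move=> p; rewrite /= mem_primes => /andP[pp _]; exact: finite_above_prime.
apply: sub_finite_set fin => v /= va.
have {va} : 0 < v (`|a|%N)%:R.
  have : a%:~R = (-1) ^+ (a < 0)%R * (`|a|%N)%:R :> F.
    by rewrite {1}[a]intEsign rmorphM rmorph_sign.
  by case: (a < 0)%R => e; move: va; rewrite e ?expr1 ?expr0 ?mul1r ?mulN1r// dvalN.
have : (0 < `|a|)%N by rewrite absz_gt0.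
move: (`|a|)%N => n.
rewrite -!/(is_true _) => n0 vn; suff : exists2 p, p \in primes n & 0 < v p%:R.
  by move=> [p pn vp]; exists p.
have [k] := ubnP n; elim: k n n0 vn => // k ih n n0 vn nk.
have [n1|n1] := leqP n 1.
  have {}n1 : n = 1%N by apply/eqP; rewrite eqn_leq n1.
  by move: vn; rewrite n1 dval1.
have pdp := pdiv_prime n1; have [m nE] := dvdnP (pdiv_dvd n).
have natF (l : nat) : (0 < l)%N -> l%:R != 0 :> F.
  by move=> l0; apply: (@intF_neq0 l); rewrite eqz_nat -lt0n.
have m0 : (0 < m)%N by rewrite lt0n; apply: contraTneq n0 => m0; rewrite nE m0.
have [vp|vp] := ltP 0 (v (pdiv n)%:R).
  by exists (pdiv n) => //; rewrite mem_primes pdp n0 pdiv_dvd.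
have [||p pm vpp] := ih m m0.
- have : v n%:R = v m%:R + v (pdiv n)%:R.
    by rewrite {1}nE natrM dvalM ?natF// prime_gt0.
  by move=> e; move: vn; rewrite e => /lt_le_trans; apply; rewrite gerDl.
- rewrite -ltnS; apply: leq_trans nk; rewrite ltnS.
  by have := ltn_Pmulr (prime_gt1 pdp) m0; rewrite -nE.
exists p => //; move: pm; rewrite !mem_primes n0 => /and3P[-> _ pm] /=.
by rewrite nE dvdn_mulr.
Qed.

(* Hence F embeds diagonally in the restricted product. *)
Lemma finite_nonintegral x : finite_set [set v : dvaluation F | ~ vge v 0 x].
Proof.
have /choice[c cE] (i : nat) : exists k : rat, (minPoly 1 x)`_i = k%:A.
  by apply/vlineP; exact: (polyOverP (minPolyOver 1 x)).
pose d := (size (minPoly 1 x)).-1.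
have fin : finite_set (\bigcup_(i in `I_d)
    [set v : dvaluation F | 0 < v (denq (c i))%:~R]).
  apply: bigcup_finite; first exact: finite_II.
  by move=> i _; apply: finite_above_int; exact: denq_neq0.
apply: sub_finite_set fin => v /= vx; apply: contrapT => h.
have x0 : x != 0 by apply/eqP => x0; apply: vx; left.
have {}vx : v x < 0 by rewrite ltNge; apply/negP => vx'; apply: vx; right.
have vc i : (i < d)%N -> vge v 0 (c i)%:A.
  move=> id; have d0 := intF_neq0 (denq_neq0 (c i)).
  have vd : v (denq (c i))%:~R = 0.
    apply/eqP; rewrite eq_le (vge_val d0 (vge_int _ _)) andbT leNgt.
    by apply/negP => vd; apply: h; exists i.
  have -> : (c i)%:A = (numq (c i))%:~R / (denq (c i))%:~R :> F.
    by rewrite -[LHS]/(in_alg F _) -{1}[c i]divq_num_den fmorph_div !rmorph_int.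
  rewrite -[0]add0r; apply: vgeM; first exact: vge_int.
  by right; rewrite dvalV// vd oppr0.
have d0 : (0 < d)%N by rewrite /d size_minPoly.
have sE : size (minPoly 1 x) = d.+1 by rewrite /d prednK// size_minPoly.
have : vge v (d%:Z * v x + 1) (- x ^+ d).
  have := root_minPoly 1 x; rewrite /root horner_coef sE big_ord_recr /=.
  have -> : (minPoly 1 x)`_d = 1 by apply/eqP; exact: monic_minPoly.
  rewrite mul1r addr_eq0 => /eqP <-; apply: vge_sum => i _.
  have : vge v (0 + i%:Z * v x) ((minPoly 1 x)`_i * x ^+ i).
    apply: vgeM; first by rewrite cE; exact: vc.
    by right; rewrite -[x ^+ i]/(x ^ i%:Z) dvalX.
  apply: vgeW; rewrite add0r; have := ltn_ord i; move: vx; clear; nia.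
move=> /vgeN; rewrite opprK => /(vge_val (expf_neq0 _ x0)).
by rewrite -[x ^+ d]/(x ^ d%:Z) dvalX// gerDl.
Qed.

End FinitePlaces.

(* A completion of F at a finite place, given by its characteristic property: a
   complete discretely valued field in which F is dense, with the valuation
   extending v. It is unique up to a unique isomorphism. *)
Record completion (F : fieldType) (v : dvaluation F) := Completion {
  cfield :> fieldType;
  cval : dvaluation cfield;
  cemb : {rmorphism F -> cfield};
  cembE : forall x, cval (cemb x) = v x;
  cdense : forall (n : int) y, exists x, vge cval n (y - cemb x);
  ccomplete : forall u : nat -> cfield,
    (forall n : int, exists N : nat, forall i j : nat, (N <= i)%N -> (N <= j)%N ->
      vge cval n (u i - u j)) ->
    exists l, forall n : int, exists N : nat, forall i : nat, (N <= i)%N ->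
      vge cval n (u i - l) }.

Definition residue_field (K : fieldType) (v : dvaluation K) : set (set K) :=
  [set [set y | vge v 1 (y - x)] | x in [set x | vge v 0 x]].

Definition residue_card (K : fieldType) (v : dvaluation K) : nat :=
  #|` fset_set (residue_field v)|%fset.

(* The normalized absolute value |x|_v = q_v^(- v(x)). *)
Definition vabs (R : realType) (K : fieldType) (v : dvaluation K) (x : K) : R :=
  if x == 0 then 0 else (residue_card v)%:R ^ (- v x).

Lemma vge_emb (F : fieldType) (v : dvaluation F) (Kv : completion v) n x :
  vge v n x -> vge (cval Kv) n (cemb Kv x).
Proof. by move=> [->|h]; [left; rewrite rmorph0|right; rewrite cembE]. Qed.

Section FiniteAdeles.
Variables (F : fieldExtType rat) (K : forall v : dvaluation F, completion v).

Record fin_adele := FinAdele {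
  fa :> forall v, K v;
  fa_int : finite_set [set v | ~ vge (cval (K v)) 0 (fa v)] }.

HB.instance Definition _ := gen_eqMixin fin_adele.
HB.instance Definition _ := gen_choiceMixin fin_adele.

Lemma fin_adeleP (x y : fin_adele) : (forall v, x v = y v) -> x = y.
Proof.
case: x y => [x hx] [y hy] /= xy.
have {}xy : x = y by exact: functional_extensionality_dep.
subst y.
by congr FinAdele; exact: Prop_irrelevance.
Qed.

Lemma fa0_int : finite_set [set v | ~ vge (cval (K v)) 0 0].
Proof.
apply: (sub_finite_set _ (finite_set0 _)) => v /= []; exact: vge0.
Qed.

Lemma fa1_int : finite_set [set v | ~ vge (cval (K v)) 0 1].
Proof.
by apply: (sub_finite_set _ (finite_set0 _)) => v /= []; right; rewrite dval1.
Qed.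

Lemma faN_int (x : fin_adele) :
  finite_set [set v | ~ vge (cval (K v)) 0 (- x v)].
Proof.
apply: sub_finite_set (fa_int x) => v /= h h'; apply: h; exact: vgeN.
Qed.

Lemma faD_int (x y : fin_adele) :
  finite_set [set v | ~ vge (cval (K v)) 0 (x v + y v)].
Proof.
have : finite_set ([set v | ~ vge (cval (K v)) 0 (x v)] `|`
                   [set v | ~ vge (cval (K v)) 0 (y v)]).
  by rewrite finite_setU; split; exact: fa_int.
apply: sub_finite_set => v /= h; apply/not_andP => -[hx hy].
by apply: h; exact: vgeD.
Qed.

Lemma faM_int (x y : fin_adele) :
  finite_set [set v | ~ vge (cval (K v)) 0 (x v * y v)].
Proof.
have : finite_set ([set v | ~ vge (cval (K v)) 0 (x v)] `|`
                   [set v | ~ vge (cval (K v)) 0 (y v)]).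
  by rewrite finite_setU; split; exact: fa_int.
apply: sub_finite_set => v /= h; apply/not_andP => -[hx hy].
by apply: h; rewrite -[0]addr0; exact: vgeM.
Qed.

Definition fa_zero := FinAdele fa0_int.
Definition fa_one := FinAdele fa1_int.
Definition fa_opp (x : fin_adele) := FinAdele (faN_int x).
Definition fa_add (x y : fin_adele) := FinAdele (faD_int x y).
Definition fa_mul (x y : fin_adele) := FinAdele (faM_int x y).

Fact fa_addA : associative fa_add.
Proof. by move=> x y z; apply: fin_adeleP => v /=; rewrite addrA. Qed.
Fact fa_addC : commutative fa_add.
Proof. by move=> x y; apply: fin_adeleP => v /=; rewrite addrC. Qed.
Fact fa_add0 : left_id fa_zero fa_add.
Proof. by move=> x; apply: fin_adeleP => v /=; rewrite add0r. Qed.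
Fact fa_addN : left_inverse fa_zero fa_opp fa_add.
Proof. by move=> x; apply: fin_adeleP => v /=; rewrite addNr. Qed.
HB.instance Definition _ :=
  GRing.isZmodule.Build fin_adele fa_addA fa_addC fa_add0 fa_addN.

Fact fa_mulA : associative fa_mul.
Proof. by move=> x y z; apply: fin_adeleP => v /=; rewrite mulrA. Qed.
Fact fa_mulC : commutative fa_mul.
Proof. by move=> x y; apply: fin_adeleP => v /=; rewrite mulrC. Qed.
Fact fa_mul1 : left_id fa_one fa_mul.
Proof. by move=> x; apply: fin_adeleP => v /=; rewrite mul1r. Qed.
Fact fa_mulD : left_distributive fa_mul fa_add.
Proof. by move=> x y z; apply: fin_adeleP => v /=; rewrite mulrDl. Qed.
HB.instance Definition _ :=
  GRing.Zmodule_isComPzRing.Build fin_adele fa_mulA fa_mulC fa_mul1 fa_mulD.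

(* x + prod_v p_v^(N v), with N v = 0 for almost all v: a basis of neighbourhoods
   of x in the restricted product topology. *)
Definition fa_ball (N : dvaluation F -> nat) (x : fin_adele) : set fin_adele :=
  [set y | forall v, vge (cval (K v)) (N v)%:Z (y v - x v)].

Definition fa_open (U : set fin_adele) : Prop := forall x, U x ->
  exists2 N, finite_set [set v | N v != 0%N] & fa_ball N x `<=` U.

Fact fa_openT : fa_open setT.
Proof.
move=> x _; exists (fun=> 0%N) => //.
by apply: (sub_finite_set _ (finite_set0 _)) => v /=.
Qed.

Fact fa_openI : setI_closed fa_open.
Proof.
move=> U V oU oV x [/oU[N fN NU] /oV[M fM MV]].
exists (fun v => maxn (N v) (M v)).
  have : finite_set ([set v | N v != 0%N] `|` [set v | M v != 0%N]).
    by rewrite finite_setU.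
  by apply: sub_finite_set => v /=; case: (N v) => [|n]; [rewrite max0n; right|left].
move=> y h; split; [apply: NU|apply: MV] => v; apply: vgeW (h v).
  by rewrite lez_nat leq_maxl.
by rewrite lez_nat leq_maxr.
Qed.

Fact fa_open_bigU (I : Type) (f : I -> set fin_adele) :
  (forall i, fa_open (f i)) -> fa_open (\bigcup_i f i).
Proof.
move=> h x [i _ /h[N fN Nf]]; exists N => // y /Nf; by exists i.
Qed.

HB.instance Definition _ :=
  isOpenTopological.Build fin_adele fa_openT fa_openI fa_open_bigU.

Definition fin_diag (x : F) : fin_adele.
Proof.
apply: (@FinAdele (fun v => cemb (K v) x)).
apply: sub_finite_set (finite_nonintegral x) => v /= h h'; apply: h.
exact: vge_emb.
Defined.

End FiniteAdeles.

Definition real_place (R : realType) (F : fieldExtType rat) : Type :=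
  {rmorphism F -> R}.
HB.instance Definition _ (R : realType) (F : fieldExtType rat) := gen_eqMixin (real_place R F).
HB.instance Definition _ (R : realType) (F : fieldExtType rat) := gen_choiceMixin (real_place R F).

Definition totally_real (R : realType) (F : fieldExtType rat) : Prop :=
  forall (f : {rmorphism F -> R[i]}) (x : F), complex.Im (f x) = 0.

Definition inf_adele (R : realType) (F : fieldExtType rat) : Type :=
  {ptws real_place R F -> R}.
HB.instance Definition _ (R : realType) (F : fieldExtType rat) :=
  GRing.ComPzRing.copy (inf_adele R F) (real_place R F -> R).
HB.instance Definition _ (R : realType) (F : fieldExtType rat) :=
  Topological.copy (inf_adele R F) {ptws real_place R F -> R}.

(* For F totally real, all archimedean completions are R, indexed by the real
   embeddings of F. *)
Definition adele (R : realType) (F : fieldExtType rat)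
    (K : forall v : dvaluation F, completion v) : Type :=
  (inf_adele R F * fin_adele K)%type.
HB.instance Definition _ (R : realType) (F : fieldExtType rat)
    (K : forall v : dvaluation F, completion v) :=
  GRing.ComPzRing.copy (adele R K) (inf_adele R F * fin_adele K)%type.
HB.instance Definition _ (R : realType) (F : fieldExtType rat)
    (K : forall v : dvaluation F, completion v) :=
  Topological.copy (adele R K) (inf_adele R F * fin_adele K)%type.

(* Units as pairs (x, x^-1): the library's units need 1 != 0. *)
Record units (A : comPzRingType) := Units {
  uval :> A;
  uinv : A;
  uvalV : uval * uinv = 1 }.

Section Units.
Variable A : comPzRingType.
Implicit Types t u w : units A.

Lemma units_inj t u : uval t = uval u -> t = u.
Proof.
move: t u => [x x' xx'] [y y' yy'] /= xy; subst y.
have x'y' : x' = y' by rewrite -[x']mulr1 -yy' mulrA [x' * x]mulrC xx' mul1r.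
by subst y'; congr Units; exact: Prop_irrelevance.
Qed.

Definition unit1 : units A := Units (mulr1 1).

Definition unitV t : units A.
Proof. by apply: (@Units A (uinv t) (uval t)); rewrite mulrC uvalV. Defined.

Definition unitM t u : units A.
Proof.
apply: (@Units A (uval t * uval u) (uinv t * uinv u)).
by rewrite mulrACA !uvalV mulr1.
Defined.

Record GL2 := MkGL2 {
  gmx :> 'M[A]_2;
  gmxV : 'M[A]_2;
  gmulmV : gmx *m gmxV = 1%:M;
  gmulVm : gmxV *m gmx = 1%:M }.

Definition gmul (g h : GL2) : GL2.
Proof.
apply: (@MkGL2 (gmx g *m gmx h) (gmxV h *m gmxV g)).
  by rewrite mulmxA -(mulmxA (gmx g)) gmulmV mulmx1 gmulmV.
by rewrite mulmxA -(mulmxA (gmxV h)) gmulVm mulmx1 gmulVm.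
Defined.

Definition gscal (t : units A) : GL2.
Proof.
by apply: (@MkGL2 (uval t)%:M (uinv t)%:M);
  rewrite -scalar_mxM ?uvalV// mulrC uvalV.
Defined.

Definition gdet (g : GL2) : units A.
Proof. by apply: (@Units A (\det (gmx g)) (\det (gmxV g))); rewrite -det_mulmx gmulmV det1. Defined.

End Units.

Definition gmap (A B : comPzRingType) (f : {rmorphism A -> B}) (g : GL2 A) : GL2 B.
Proof.
by apply: (@MkGL2 B (map_mx f (gmx g)) (map_mx f (gmxV g)));
  rewrite -map_mxM ?gmulmV ?gmulVm map_mx1.
Defined.

Section Ideles.
Variables (R : realType) (F : fieldExtType rat).
Variable K : forall v : dvaluation F, completion v.
Local Notation AF := (adele R K).

Definition diag (x : F) : AF :=
  ((fun s : real_place R F => (s : {rmorphism F -> R}) x), fin_diag K x).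

Fact diag_zmod : zmod_morphism diag.
Proof.
move=> x y; congr (_, _); first by apply/funext => s; exact: rmorphB.
by apply: fin_adeleP => v; exact: rmorphB.
Qed.
HB.instance Definition _ := GRing.isZmodMorphism.Build F AF diag diag_zmod.

Fact diag_monoid : monoid_morphism diag.
Proof.
split.
  congr (_, _); first by apply/funext => s; exact: rmorph1.
  by apply: fin_adeleP => v; exact: rmorph1.
move=> x y; congr (_, _); first by apply/funext => s; exact: rmorphM.
by apply: fin_adeleP => v; exact: rmorphM.
Qed.
HB.instance Definition _ := GRing.isMonoidMorphism.Build F AF diag diag_monoid.

Definition idele : Type := units AF.

HB.instance Definition _ := gen_eqMixin idele.
HB.instance Definition _ := gen_choiceMixin idele.
HB.instance Definition _ := isPointed.Build idele (unit1 AF).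
(* The idelic topology, induced by t |-> (t, t^-1), not by the inclusion in the
   adeles. *)
HB.instance Definition _ := Topological.copy idele
  (initial_topology (fun t : idele => (uval t, uinv t) : AF * AF)).

Definition principal (x : {x : F | x != 0}) : idele.
Proof.
apply: (@Units AF (diag (sval x)) (diag (sval x)^-1)).
by rewrite -rmorphM divff ?rmorph1//; exact: (svalP x).
Defined.

Definition idelic_norm (t : idele) : R :=
  (\big[*%R/1]_(s \in [set: real_place R F]) `|(uval t).1 s|) *
  (\big[*%R/1]_(v \in [set: dvaluation F]) vabs R (cval (K v)) ((uval t).2 v)).

Definition idele_equiv (t u : idele) : bool :=
  `[< exists x, u = unitM (principal x) t >].

Fact idele_equiv_refl : reflexive idele_equiv.
Proof.
move=> t; apply/asboolP; exists (exist _ 1 (oner_neq0 F)).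
by apply: units_inj; rewrite /= rmorph1 mul1r.
Qed.

Fact idele_equiv_sym : symmetric idele_equiv.
Proof.
suff h t u : idele_equiv t u -> idele_equiv u t.
  by move=> t u; apply/idP/idP; exact: h.
move=> /asboolP[x ->]; apply/asboolP.
have x0 : (sval x)^-1 != 0 by rewrite invr_eq0; exact: (svalP x).
exists (exist _ (sval x)^-1 x0); apply: units_inj.
by rewrite /= mulrA -rmorphM mulVf ?rmorph1 ?mul1r//; exact: (svalP x).
Qed.

Fact idele_equiv_trans : transitive idele_equiv.
Proof.
move=> u t w /asboolP[x ->] /asboolP[y ->]; apply/asboolP.
have xy0 : sval y * sval x != 0.
  by rewrite mulf_neq0//; [exact: (svalP y)|exact: (svalP x)].
exists (exist _ (sval y * sval x) xy0); apply: units_inj.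
by rewrite /= rmorphM mulrA.
Qed.

Canonical idele_equivRel :=
  EquivRel idele_equiv idele_equiv_refl idele_equiv_sym idele_equiv_trans.

Definition idele_class : Type := quotient_topology {eq_quot idele_equiv}.
HB.instance Definition _ := PointedTopological.on idele_class.

Definition class_repr (q : idele_class) : idele :=
  repr (q : {eq_quot idele_equiv}).

End Ideles.

Notation borel X := (g_sigma_algebraType (@open X)).

(* The idele group is second countable, so that regularity is automatic. *)
Definition is_haar (R : realType) (F : fieldExtType rat)
    (K : forall v : dvaluation F, completion v)
    (mu : {measure set (borel (idele R K)) -> \bar R}) : Prop :=
  [/\ forall (t : idele R K) (U : set (borel (idele R K))), measurable U ->
        mu [set unitM t u | u in U] = mu U,
      forall C : set (idele R K), compact C -> (mu C < +oo)%E
    & forall U : set (idele R K), open U -> U !=set0 -> (0 < mu U)%E].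

(* Weil's formula, which characterises the quotient of mu by the counting measure
   on F^x. *)
Definition is_quotient_measure (R : realType) (F : fieldExtType rat)
    (K : forall v : dvaluation F, completion v)
    (mu : {measure set (borel (idele R K)) -> \bar R})
    (nu : {measure set (borel (idele_class R K)) -> \bar R}) : Prop :=
  forall f : borel (idele R K) -> \bar R,
    measurable_fun setT f -> (forall t, (0 <= f t)%E) ->
    (\int[mu]_t f t =
     \int[nu]_q \esum_(x in [set: {x : F | (x != 0)%R}])
        f (unitM (principal R K x) (class_repr q)))%E.

Section Complex.
Variable R : realType.
Local Notation C := (R[i]^o).

Definition cpow (a : R) (z : R[i]) : R[i] :=
  let m := expR (complex.Re z * ln a) in let th := complex.Im z * ln a in
  (m * cos th) +i* (m * sin th).

(* Sums of absolutely summable families. *)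
Definition rsum (T : choiceType) (D : set T) (f : T -> R) : R :=
  fine (\esum_(i in D) (f^\+ i)%:E) - fine (\esum_(i in D) (f^\- i)%:E).

Definition csum (T : choiceType) (D : set T) (f : T -> R[i]) : R[i] :=
  rsum D (fun i => complex.Re (f i)) +i* rsum D (fun i => complex.Im (f i)).

Definition cintegral d (T : measurableType d) (mu : {measure set T -> \bar R})
    (f : T -> R[i]) : R[i] :=
  Rintegral mu setT (fun x => complex.Re (f x)) +i*
  Rintegral mu setT (fun x => complex.Im (f x)).

Definition meromorphic_at (f : C -> C) (a : C) : Prop :=
  exists (k : nat) (c : nat -> C), \forall z \near a^',
    series (fun n => c n * (z - a) ^+ n) @ \oo --> (z - a) ^+ k * f z.

Definition meromorphic (f : C -> C) : Prop := forall a, meromorphic_at f a.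

(* Equality of meromorphic functions: values at poles are irrelevant. *)
Definition meromorphic_eq (f g : C -> C) : Prop :=
  forall a : C, \forall z \near a^', f z = g z.

End Complex.

Section Schwartz.
Variables (R : realType) (J : Type).
Implicit Types (f : (J -> R) -> R) (x : J -> R) (s : seq J).

Definition perturb x (j : J) (t : R) : J -> R :=
  fun k => x k + (if `[< k = j >] then t else 0).

Definition pderiv (j : J) f : (J -> R) -> R :=
  fun x => derive1 (fun t : R => f (perturb x j t)) 0.

Definition pderivs s f : (J -> R) -> R := foldr pderiv f s.

(* sup |x^alpha d^beta f| < oo, the multi-indices being sequences of
   coordinates. *)
Definition schwartz f : Prop :=
  [/\ forall s j x, derivable (fun t : R => pderivs s f (perturb x j t)) 0 1,
      forall s, continuous (pderivs s f : {ptws J -> R} -> R)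
    & forall s s', exists M : R, forall x,
        `|(\prod_(j <- s) x j) * pderivs s' f x| <= M].

Definition cschwartz (f : (J -> R) -> R[i]) : Prop :=
  schwartz (fun x => complex.Re (f x)) /\ schwartz (fun x => complex.Im (f x)).

End Schwartz.

Section Eisenstein.
Variables (R : realType) (F : fieldExtType rat).
Variable K : forall v : dvaluation F, completion v.
Local Notation AF := (adele R K).

(* (A_inf)^2 = R^J, where J = {real places} x {0, 1}. *)
Definition inf_part (x : 'cV[AF]_2) : real_place R F * 'I_2 -> R :=
  fun p => (x p.2 0).1 p.1.

Definition fin_part (x : 'cV[AF]_2) : 'cV[fin_adele K]_2 :=
  \col_i (x i 0).2.

Definition locally_constant (f : 'cV[fin_adele K]_2 -> R[i]) : Prop :=
  forall x, \forall y \near x, f y = f x.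

Definition compactly_supported (f : 'cV[fin_adele K]_2 -> R[i]) : Prop :=
  compact (closure [set x | f x != 0]).

(* S(A^2) is the algebraic tensor product of the Schwartz space of (A_inf)^2 and
   of the space of locally constant compactly supported functions on (A_f)^2. *)
Definition schwartz_bruhat (phi : 'cV[AF]_2 -> R[i]) : Prop :=
  exists (m : nat) (a : 'I_m -> (real_place R F * 'I_2 -> R) -> R[i])
         (b : 'I_m -> 'cV[fin_adele K]_2 -> R[i]),
    [/\ forall i, cschwartz (a i),
        forall i, locally_constant (b i) /\ compactly_supported (b i)
      & forall x, phi x = \sum_(i < m) a i (inf_part x) * b i (fin_part x)].

Definition unitary_hecke_character (omega : idele R K -> R[i]) : Prop :=
  [/\ forall t u, omega (unitM t u) = omega t * omega u,
      continuous (omega : idele R K -> R[i]^o),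
      forall t, `|omega t| = 1
    & forall x, omega (principal R K x) = 1].

Definition theta (phi : 'cV[AF]_2 -> R[i]) (g : GL2 AF) : R[i] :=
  csum [set v : 'cV[F]_2 | v != 0]
    (fun v => phi (gmxV g *m map_mx (@diag R F K) v)).

(* E^ana as an integral, for Re s > 1. The integrand only depends on the class
   of t. *)
Definition eisenstein_integral (omega : idele R K -> R[i])
    (phi : 'cV[AF]_2 -> R[i])
    (nu : {measure set (borel (idele_class R K)) -> \bar R})
    (g : GL2 AF) (s : R[i]) : R[i] :=
  cpow (idelic_norm (gdet g)) (- s) *
  cintegral nu (fun q => let t := class_repr q in
    omega t * cpow (idelic_norm t) (2 * s) *
    theta phi (gmul (gscal (unitV t)) g)).

(* E is the meromorphic continuation of s |-> E^ana_{omega,s}(phi)(g). *)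
Definition is_eisenstein (omega : idele R K -> R[i]) (phi : 'cV[AF]_2 -> R[i])
    (nu : {measure set (borel (idele_class R K)) -> \bar R})
    (g : GL2 AF) (E : R[i] -> R[i]) : Prop :=
  meromorphic E /\
  forall s, 1 < complex.Re s -> E s = eisenstein_integral omega phi nu g s.

End Eisenstein.

(* Main.v *)
Require Import Defs.
From HB Require Import structures.
From mathcomp Require Import all_boot all_order all_algebra all_field.
From mathcomp Require Import finmap complex.
From mathcomp Require Import all_classical all_reals all_analysis.
From mathcomp Require Import zify ring lra.
Import Order.TTheory GRing.Theory Num.Theory.
Import numFieldNormedType.Exports.
Set Implicit Arguments.
Unset Strict Implicit.
Unset Printing Implicit Defensive.
Local Open Scope classical_set_scope.
Local Open Scope ring_scope.

(* Substituting v -> gamma^-1 v in the sum defining Theta shows that Theta is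
   invariant under gamma, and |det gamma| = 1 by the product formula, so the two
   integrals agree for Re s > 1; the identity theorem for meromorphic functions
   does the rest.

   The product formula is obtained by counting. Let P x be the idelic norm of x.
   Writing numbers in base x with digits running through the residues modulo x,
   and comparing with the number of lattice points in a box, gives P x >= 1 when
   x is integral with all conjugates at least 2 in absolute value. The pigeonhole
   principle gives P m <= 1 for positive integers m: otherwise the lattice
   contains a nonzero element divisible by m at all finite places whose quotient
   by m has all conjugates less than 1 in absolute value. The quotient is an
   algebraic integer, hence 0, because its powers stay in a lattice. So P m = 1
   for integers m > 1, then P x >= 1 for all x != 0, and P x^-1 >= 1 concludes. *)

(** * Valuation rings of number fields *)

(** Finite places are given axiomatically, as discrete valuations, and nothing ties them to a ring
    of integers. Two facts therefore have to be proved: an element integral at every place satisfies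
    a monic equation over [int], and residue fields are finite. The first rests on Chevalley's
    theorem on valuation rings and on the discreteness of every proper valuation ring of [F]; the
    second is the digit count in base p at a single place. The lattice is just the Z-span of a
    Q-basis, so each comparison of residues with lattice points carries an unknown constant; letting
    the number of digits, or the exponent k in m^k, tend to infinity removes it. Total reality makes
    all complex embeddings real, so their number is the degree and the conjugates of a basis form an
    invertible square matrix over [R]. *)

Definition subring_set (F : fieldType) (A : set F) : Prop :=
  [/\ A 1, forall x y, A x -> A y -> A (x - y)
    & forall x y, A x -> A y -> A (x * y)].

Section SubringSet.
Variables (F : fieldType) (A : set F).
Hypothesis sA : subring_set A.
Implicit Types x y : F.

Lemma subring0 : A 0.
Proof. by have [a1 aB _] := sA; rewrite -(subrr 1); exact: aB. Qed.

Lemma subringN x : A x -> A (- x).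
Proof. by have [_ aB _] := sA => ax; rewrite -sub0r; apply: aB => //; exact: subring0. Qed.

Lemma subringD x y : A x -> A y -> A (x + y).
Proof. by have [_ aB _] := sA => ax ay; rewrite -(opprK y); apply: aB => //; exact: subringN. Qed.

Lemma subringM x y : A x -> A y -> A (x * y).
Proof. by have [_ _ aM] := sA; exact: aM. Qed.

Lemma subring_sum (I : Type) (r : seq I) (P : pred I) (f : I -> F) :
  (forall i, P i -> A (f i)) -> A (\sum_(i <- r | P i) f i).
Proof. by move=> h; apply: big_ind => //; [exact: subring0|exact: subringD]. Qed.

Lemma subringX x n : A x -> A (x ^+ n).
Proof.
move=> ax; elim: n => [|n ih]; first by rewrite expr0; case: sA.
by rewrite exprS; exact: subringM.
Qed.

Lemma subring_nat n : A n%:R.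
Proof.
elim: n => [|n ih]; first exact: subring0.
by rewrite -natr1; apply: subringD => //; case: sA.
Qed.

Lemma subring_int (n : int) : A n%:~R.
Proof.
case: n => n; first exact: subring_nat.
by rewrite NegzE rmorphN; apply: subringN; exact: subring_nat.
Qed.

Definition adjoin u : set F :=
  [set x | exists2 p : {poly F}, (forall i, A p`_i) & x = p.[u]].

Lemma sub_adjoin u : A `<=` adjoin u.
Proof.
move=> x ax; exists x%:P; last by rewrite hornerC.
by move=> i; rewrite coefC; case: eqP => // _; exact: subring0.
Qed.

Lemma mem_adjoin u : adjoin u u.
Proof.
exists 'X; last by rewrite hornerX.
by move=> i; rewrite coefX; case: eqP => _; [case: sA|exact: subring0].
Qed.

Lemma adjoin_subring u : subring_set (adjoin u).
Proof.
split; first by apply: sub_adjoin; case: sA.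
- move=> _ _ [p pA ->] [q qA ->]; exists (p - q); last by rewrite hornerD hornerN.
  by move=> i; rewrite coefB; apply: subringD => //; exact: subringN.
- move=> _ _ [p pA ->] [q qA ->]; exists (p * q); last by rewrite hornerM.
  by move=> i; rewrite coefM; apply: subring_sum => j _; exact: subringM.
Qed.

End SubringSet.

Definition valuation_ring (F : fieldType) (O : set F) : Prop :=
  subring_set O /\ forall u, O u \/ O u^-1.

(** * Chevalley's argument: subrings maximal among those omitting z^-1 *)

Section MaximalSubring.
Variables (F : fieldType) (z : F) (A : set F).
Hypotheses (z0 : z != 0) (sA : subring_set A) (Az : A z) (AzV : ~ A z^-1).
Hypothesis Amax : forall B, A `<` B -> subring_set B -> B z -> B z^-1.

(** [I] is the principal ideal zA. It is proper, since 1 in [I] would put z^-1 in [A]; the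
    contradictions below all come from this. *)
Let I x := A (z^-1 * x).

Let IA x : I x -> A x.
Proof. by move=> ix; rewrite -(mulVKf z0 x); exact: subringM. Qed.

Let ID x y : I x -> I y -> I (x + y).
Proof. by rewrite /I mulrDr; exact: subringD. Qed.

Let IM a x : A a -> I x -> I (a * x).
Proof. by rewrite /I mulrCA; exact: subringM. Qed.

(** [A][u] is strictly larger than [A], so maximality gives z^-1 = p(u). Multiplying by z moves the
    coefficients into [I]. *)
Lemma max_adjoin u : ~ A u -> exists2 p : {poly F}, (forall i, I p`_i) & p.[u] = 1.
Proof.
move=> uA; have [|||p pA pz] := @Amax (adjoin A u).
- split; last by move=> h; apply: uA; apply: h; exact: mem_adjoin.
  exact: sub_adjoin.
- exact: adjoin_subring.
- exact: sub_adjoin.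
exists (z *: p); last by rewrite hornerZ -pz mulfV.
by move=> i; rewrite /I coefZ mulKf.
Qed.

(** [I] lies in the Jacobson radical: were (1-b)^-1 outside [A], [max_adjoin] would write 1 as a
    polynomial in it with coefficients in [I]. Clearing denominators puts a power of 1-b in [I],
    although such powers are congruent to 1 modulo [I]. *)
Let unit1B b : I b -> 1 - b != 0 /\ A (1 - b)^-1.
Proof.
move=> ib; have b1 : 1 - b != 0.
  apply/eqP => /eqP; rewrite subr_eq0 => /eqP e; apply: AzV.
  by move: ib; rewrite -e /I mulr1.
split => //; apply: contrapT => /max_adjoin[p pI p1].
have AB : A (1 - b) by apply: subringD => //; [case: sA|apply: subringN; [exact: sA|exact: IA]].
suff : I 1 by rewrite /I mulr1.
have hN N : I ((1 - b) ^+ N) -> I 1.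
  have : I (1 - (1 - b) ^+ N).
    elim: N => [|N ih]; first by rewrite expr0 subrr /I mulr0; exact: subring0.
    have -> : 1 - (1 - b) ^+ N.+1 = (1 - b) * (1 - (1 - b) ^+ N) + b by rewrite exprS; ring.
    by apply: ID => //; exact: IM.
  by move=> h1 h2; have := ID h1 h2; rewrite subrK.
apply: (hN (size p)); rewrite -[X in I X]mulr1 -[X in _ * X]p1 horner_coef mulr_sumr.
apply: (big_ind I); [by rewrite /I mulr0; exact: subring0|exact: ID|] => i _.
have -> : (1 - b) ^+ size p * (p`_i * (1 - b)^-1 ^+ i) =
   ((1 - b) ^+ (size p - i)) * p`_i.
  rewrite -{1}(subnK (ltnW (ltn_ord i))) exprD exprVn.
  by field; rewrite expf_neq0.
by apply: IM => //; exact: subringX.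
Qed.

(** The relation [q] says that 1 - q_0 is the sum of the q_i u^-i over i > 0. As 1 - q_0 is a unit
    of [A], multiplying by u^k expresses u^k through lower powers of u and eliminates the leading
    term of [p]. *)
Let reduce u (p q : {poly F}) : u != 0 ->
  (forall i, I p`_i) -> (forall i, I q`_i) -> p.[u] = 1 -> q.[u^-1] = 1 ->
  (size q <= size p)%N ->
  exists p' : {poly F}, [/\ forall i, I p'`_i, p'.[u] = 1 & (size p' < size p)%N].
Proof.
move=> u0 pI qI p1 q1 sqp; have [b1 Ab] := unit1B (qI 0%N).
have sp : (0 < size p)%N.
  by rewrite lt0n size_poly_eq0; apply/eqP => p0; move: p1; rewrite p0 horner0 => /eqP; rewrite eq_sym oner_eq0.
set k := (size p).-1; have spk : size p = k.+1 by rewrite /k prednK.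
pose c j := q`_j / (1 - q`_0).
exists (\poly_(i < k) (p`_i + p`_k * c (k - i)%N)); split.
- move=> i; rewrite coef_poly; case: ifP => _; last by rewrite /I mulr0; exact: subring0.
  apply: ID => //; apply: IM; first exact: IA.
  by rewrite /c mulrC; exact: IM.
- rewrite horner_poly.
  under eq_bigr do rewrite mulrDl.
  rewrite big_split /= -[RHS]p1 horner_coef spk big_ord_recr /=; congr (_ + _).
  under eq_bigr do rewrite -mulrA.
  rewrite -big_distrr /=; congr (_ * _).
  rewrite (reindex_inj rev_ord_inj) /=.
  have e : \sum_(i < k) q`_i.+1 * u^-1 ^+ i.+1 = 1 - q`_0.
    by rewrite -[in RHS]q1 (@horner_coef_wide _ k.+1) -?spk// spk big_ord_recl
      expr0 mulr1 addrAC subrr add0r.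
  apply: (mulfI b1); rewrite -[in RHS]e mulr_sumr mulr_suml.
  apply: eq_bigr => i _; have ik := ltn_ord i; rewrite /c subKn//.
  have -> : u ^+ k = u ^+ (k - i.+1) * u ^+ i.+1 by rewrite -exprD subnK.
  rewrite exprVn; have h : u ^+ i.+1 != 0 by rewrite expf_neq0.
  by field; rewrite h b1.
- by rewrite spk ltnS; exact: size_poly.
Qed.

Lemma max_valuation_ring : valuation_ring A.
Proof.
split=> // u; apply: contrapT => /not_orP[uA uVA].
have u0 : u != 0 by apply/eqP => u0; apply: uA; rewrite u0; exact: subring0.
have [p pI p1] := max_adjoin uA; have [q qI q1] := max_adjoin uVA.
(* Descent on the total length: the longer relation is shortened, with u and u^-1 exchanged when
   that is [q]. *)
have [N] := ubnP (size p + size q).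
elim: N u u0 {uA uVA} p q pI p1 qI q1 => // N ih u u0 p q pI p1 qI q1 sN.
have [le|/ltnW le] := leqP (size q) (size p).
  have [p' [p'I p'1 sp']] := reduce u0 pI qI p1 q1 le.
  by apply: (ih u u0 p' q) => //; move: sN sp'; clear; lia.
have uV0 : u^-1 != 0 by rewrite invr_eq0.
have p1' : p.[u^-1^-1] = 1 by rewrite invrK.
have [q' [q'I q'1 sq']] := reduce uV0 qI pI q1 p1' le.
by apply: (ih u u0 p q') => //; move: sN sq'; clear; lia.
Qed.

End MaximalSubring.

(** Chevalley's existence theorem, by Zorn's lemma applied to the subrings that contain z but not
    z^-1. *)
Lemma valuation_ring_avoiding (F : fieldType) (z : F) (A0 : set F) : z != 0 ->
  subring_set A0 -> A0 z -> ~ A0 z^-1 ->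
  exists A : set F, [/\ valuation_ring A, A z & ~ A z^-1].
Proof.
move=> z0 sA0 A0z A0zV.
(* The chain condition of Zorn's lemma includes the empty chain, so the empty
   set has to be allowed. *)
pose P (A : set F) := [/\ forall x y, A x -> A y -> A (x - y),
  forall x y, A x -> A y -> A (x * y), ~ A z^-1 & A !=set0 -> A 1 /\ A z].
have [|A [PA Amax]] := @Zorn_bigcup F P.
  move=> C CP Ctot.
  have two x y : (\bigcup_(X in C) X) x -> (\bigcup_(X in C) X) y ->
      exists X, [/\ C X, X x & X y].
    move=> [X CX Xx] [Y CY Yy]; have [XY|YX] := Ctot X Y CX CY.
      by exists Y; split=> //; exact: XY.
    by exists X; split=> //; exact: YX.
  split.
  - move=> x y Cx Cy; have [X [CX Xx Xy]] := two _ _ Cx Cy.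
    by exists X => //; have [h _ _ _] := CP _ CX; exact: h.
  - move=> x y Cx Cy; have [X [CX Xx Xy]] := two _ _ Cx Cy.
    by exists X => //; have [_ h _ _] := CP _ CX; exact: h.
  - by move=> [X CX Xz]; have [_ _ h _] := CP _ CX.
  - move=> [x [X CX Xx]]; have [_ _ _ h] := CP _ CX.
    by have [|X1 Xz] := h; [exists x|split; exists X].
have PB B : subring_set B -> B z -> ~ B z^-1 -> P B.
  by move=> [B1 BB BM] Bz BzV; split.
(* An empty [A] would not be maximal, [A0] being a strictly larger candidate. *)
have A0' : A !=set0.
  apply: contrapT => /nonemptyPn A0'; apply: (Amax A0); last exact: PB.
  by split; [rewrite A0'; exact: sub0set|move=> /(_ _ A0z); rewrite A0'].
have [AB AM AzV /(_ A0')[A1 Az]] := PA.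
exists A; split=> //; apply: (@max_valuation_ring _ z) => //.
move=> B AB' sB Bz; apply: contrapT => BzV; exact: (Amax B AB' (PB B sB Bz BzV)).
Qed.

Lemma natF_neq0 (F : fieldExtType rat) (n : nat) : (0 < n)%N -> n%:R != 0 :> F.
Proof. by move=> n0; apply: (@intF_neq0 F n); rewrite eqz_nat -lt0n. Qed.

(** * Units and maximal ideal of a valuation ring *)

Section ValuationRing.
Variables (F : fieldType) (O : set F).
Hypothesis vO : valuation_ring O.
Let sO : subring_set O := proj1 vO.
Implicit Types (x y : F).

Let O0 : O 0 := subring0 sO.
Let O1 : O 1. Proof. by case: sO. Qed.
Let OM x y : O x -> O y -> O (x * y). Proof. exact: (subringM sO). Qed.

(** If x is outside [O], then x^-1 is in [O], and dividing the equation of degree d+1 by x^d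
    isolates the leading coefficient times x. For monic [c] this is integral closedness; the leading
    coefficient is kept in order to handle denominators. *)
Lemma valuation_ring_lead (c : {poly F}) x :
  (forall i, O c`_i) -> root c x -> O (lead_coef c * x).
Proof.
move=> cO /rootP rx; have [|xO] := pselect (O x); first by move=> ?; rewrite lead_coefE; exact: OM.
have x0 : x != 0 by apply: contra_notN xO => /eqP ->.
have xV : O x^-1 by case: (proj2 vO x).
case: (ltngtP (size c) 1) => sc.
- by move: sc; rewrite ltnS leqn0 size_poly_eq0 => /eqP ->; rewrite lead_coef0 mul0r.
- set d := (size c).-2.
  have sE : size c = d.+2 by rewrite /d; case: (size c) sc => [|[]].
  move: rx; rewrite horner_coef sE big_ord_recr /= => /eqP.
  rewrite addrC addr_eq0 => /eqP e.
  rewrite lead_coefE sE /=.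
  have -> : c`_d.+1 * x = - \sum_(i < d.+1) c`_i * x^-1 ^+ (d - i).
    have xd : x ^+ d != 0 by rewrite expf_neq0.
    apply: (mulIf xd); rewrite -mulrA -exprS e mulNr mulr_suml; congr (- _).
    apply: eq_bigr => i _; rewrite -mulrA; congr (_ * _).
    have id : (i <= d)%N by rewrite -ltnS.
    have -> : x ^+ d = x ^+ (d - i) * x ^+ i by rewrite -exprD subnK.
    by rewrite mulrA -exprMn mulVf// expr1n mul1r.
  by apply: (subringN sO); apply: subring_sum => // i _; apply: OM => //; exact: subringX.
- have /size_poly1P[a a0 cE] : size c == 1 by apply/eqP.
  by move: rx; rewrite cE hornerC => /eqP; rewrite (negbTE a0).
Qed.

Definition vr_unit x : Prop := [/\ x != 0, O x & O x^-1].
(** The case x = 0 is listed apart because 0^-1 = 0 belongs to [O]. *)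
Definition vr_max x : Prop := O x /\ (x = 0 \/ ~ O x^-1).

Lemma vr_unitM x y : vr_unit x -> vr_unit y -> vr_unit (x * y).
Proof.
move=> [x0 ox oxV] [y0 oy oyV]; split; [exact: mulf_neq0|exact: OM|].
by rewrite invfM; exact: OM.
Qed.

Lemma vr_unitV x : vr_unit x -> vr_unit x^-1.
Proof. by move=> [x0 ox oxV]; split; rewrite ?invr_eq0// invrK. Qed.

Lemma vr_unitX x n : vr_unit x -> vr_unit (x ^+ n).
Proof.
move=> [x0 ox oxV]; split; rewrite ?expf_neq0//; first exact: subringX.
by rewrite -exprVn; exact: subringX.
Qed.

Lemma vr_maxM x y : O x -> vr_max y -> vr_max (x * y).
Proof.
move=> ox [oy]; have [->|x0] := eqVneq x 0; first by rewrite mul0r; split=> //; left.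
move=> [->|yV]; first by rewrite mulr0; split=> //; left.
split; [exact: OM|right => h]; apply: yV.
by have := OM ox h; rewrite invfM mulrA mulfV// mul1r.
Qed.

(** Of two nonzero elements one divides the other in [O]; factoring out the divisor u leaves 1 +
    w/u, an element of [O]. *)
Lemma vr_maxD x y : vr_max x -> vr_max y -> vr_max (x + y).
Proof.
have [->|x0] := eqVneq x 0; first by rewrite add0r.
have [->|y0] := eqVneq y 0; first by rewrite addr0.
have main u w : u != 0 -> vr_max u -> O (w / u) -> vr_max (u + w).
  move=> u0 mu wu; have -> : u + w = (1 + w / u) * u by rewrite mulrDl mul1r divfK.
  by apply: vr_maxM => //; exact: subringD.
move=> mx my; case: (proj2 vO (y / x)) => h; first exact: main.
by rewrite addrC; apply: main => //; rewrite invf_div in h.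
Qed.

Lemma vr_max_sum (I : Type) (r : seq I) (P : pred I) (f : I -> F) :
  (forall i, P i -> vr_max (f i)) -> vr_max (\sum_(i <- r | P i) f i).
Proof.
by move=> h; apply: big_ind => //; [split=> //; left|exact: vr_maxD].
Qed.

Lemma vr_max1 : ~ vr_max 1.
Proof. by move=> [_ []]; [apply/eqP; exact: oner_neq0|rewrite invr1]. Qed.

Lemma vr_unitPn x : x != 0 -> O x -> ~ vr_unit x -> vr_max x.
Proof. by move=> x0 ox nu; split=> //; right=> oV; apply: nu. Qed.

(* If the terms had pairwise distinct valuations, the one of least valuation
   would dominate the sum. *)
Lemma vr_sum0_unit (n : nat) (t : 'I_n -> F) (i0 : 'I_n) : t i0 != 0 ->
  \sum_i t i = 0 ->
  exists i j : 'I_n, [/\ (j < i)%N, t i != 0, t j != 0 & vr_unit (t i / t j)].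
Proof.
move=> ti0 sum0; apply: contrapT => nex.
have nu i j : i != j -> t i != 0 -> t j != 0 -> ~ vr_unit (t i / t j).
  move=> ij ti tj u; apply: nex; case: (ltngtP j i) => h.
  - by exists i, j.
  - by exists j, i; split=> //; rewrite -invf_div; exact: vr_unitV.
  - by move: ij; rewrite -(inj_eq val_inj) /= h eqxx.
have [i [ti imin]] : exists i, t i != 0 /\ forall j, j \in enum 'I_n -> O (t j / t i).
  elim: (enum 'I_n) => [|k s [i [ti ih]]]; first by exists i0.
  have [tk|tk] := eqVneq (t k) 0.
    by exists i; split=> // j; rewrite inE => /predU1P[->|/ih//]; rewrite tk mul0r.
  case: (proj2 vO (t k / t i)) => h.
    by exists i; split=> // j; rewrite inE => /predU1P[->|/ih].
  exists k; split=> // j; rewrite inE => /predU1P[->|/ih ji]; first by rewrite mulfV.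
  have := OM ji h; rewrite invf_div mulrA.
  by rewrite -(mulrA (t j)) mulVf// mulr1.
apply: vr_max1; have -> : 1 = - \sum_(j < n | j != i) t j / t i.
  apply: (mulIf ti); rewrite mul1r mulNr mulr_suml; apply/eqP; rewrite -addr_eq0.
  under eq_bigr do rewrite divfK//.
  by apply/eqP; rewrite -[RHS]sum0 [in RHS](bigD1 i)//=.
rewrite -mulN1r; apply: vr_maxM; first exact: subringN.
apply: vr_max_sum => j ji; have [->|tj] := eqVneq (t j) 0; first by rewrite mul0r; split=> //; left.
apply: vr_unitPn; [by rewrite mulf_neq0// invr_eq0|by apply: imin; rewrite mem_enum|].
exact: nu.
Qed.

End ValuationRing.

(** * Proper valuation rings of a number field are discrete *)

Section DiscreteValuationRing.
Variables (F : fieldExtType rat) (O : set F).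
Hypothesis vO : valuation_ring O.
Hypothesis OnT : exists y, ~ O y.
Let sO : subring_set O := proj1 vO.
Implicit Types (x y : F).

Let O0 : O 0 := subring0 sO.
Let O1 : O 1. Proof. by case: sO. Qed.
Let OM x y : O x -> O y -> O (x * y). Proof. exact: (subringM sO). Qed.
Let Oint (n : int) : O n%:~R. Proof. exact: (subring_int sO). Qed.

Lemma ratF_div (r : rat) : r%:A = (numq r)%:~R / (denq r)%:~R :> F.
Proof. by rewrite -[LHS]/(in_alg F r) -{1}[r]divq_num_den fmorph_div !rmorph_int. Qed.

Lemma minPoly_rat (x : F) i : exists k : rat, (minPoly 1 x)`_i = k%:A.
Proof. by apply/vlineP; exact: (polyOverP (minPolyOver 1 x)). Qed.

(** The residue characteristic. Without such a p all of Q lies in [O], hence so do the roots of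
    monic rational polynomials, that is, all of [F]. *)
Lemma vr_prime : exists2 p, prime p & ~ O (p%:R)^-1.
Proof.
apply: contrapT => nex; have [y yO] := OnT; apply: yO.
have Op p : prime p -> O (p%:R)^-1.
  by move=> pp; apply: contrapT => h; apply: nex; exists p.
have On n : (0 < n)%N -> O (n%:R)^-1.
  elim/ltn_ind: n => n ih n0; have [n1|n1] := leqP n 1.
    by have -> : n = 1%N by [lia]; rewrite invr1.
  have := divnK (pdiv_dvd n) => nE.
  have pg1 := prime_gt1 (pdiv_prime n1).
  rewrite -nE natrM invfM; apply: OM; last by apply: Op; exact: pdiv_prime.
  have q0 : (0 < n %/ pdiv n)%N.
    by rewrite divn_gt0 ?(ltnW pg1)//; apply: dvdn_leq => //; exact: pdiv_dvd.
  by apply: (ih _ _ q0); apply: ltn_Pdiv => //; exact: pg1.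
have -> : y = lead_coef (minPoly 1 y) * y.
  by rewrite (eqP (monic_minPoly 1 y)) mul1r.
apply: (valuation_ring_lead vO); last exact: root_minPoly.
move=> i; have [k ->] := minPoly_rat y i; rewrite ratF_div.
apply: OM => //; rewrite -(gez0_abs (denq_ge0 k)); apply: On.
by rewrite absz_gt0 denq_neq0.
Qed.

Section Prime.
Variable p : nat.
Hypotheses (pp : prime p) (pV : ~ O (p%:R)^-1).
Notation pF := (p%:R : F).
Local Notation U := (vr_unit O).

Let p0 : pF != 0. Proof. by apply: natF_neq0; exact: prime_gt0. Qed.

Let mp : vr_max O pF.
Proof. by split; [exact: (Oint p)|right]. Qed.

Lemma vr_unit_coprime (a : nat) : (0 < a)%N -> coprime p a -> U a%:R.
Proof.
move=> a0 cpa; split; [exact: natF_neq0|exact: (Oint a)|apply: contrapT => aV].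
have ma : vr_max O (a%:R : F) by split; [exact: (Oint a)|right].
have [u [t ut]] := @Bezoutz p a.
have g1 : gcdz p a = 1 by rewrite /gcdz; move: cpa; rewrite /coprime => /eqP ->.
apply: (@vr_max1 _ O vO).
have -> : 1 = u%:~R * pF + t%:~R * a%:R :> F.
  by rewrite -[p%:R]/(p%:Z%:~R) -[a%:R]/(a%:Z%:~R) -!intrM -intrD ut g1.
by apply: vr_maxD => //; apply: vr_maxM.
Qed.

Lemma vr_unit_exp (k : int) : U (pF ^ k) -> k = 0.
Proof.
have pos (m : nat) : ~ O (pF ^- m.+1).
  move=> h; apply: pV; have -> : pF^-1 = pF ^+ m * pF ^- m.+1.
    by rewrite exprSr invfM mulVKf// expf_neq0.
  by apply: OM => //; apply: subringX => //; exact: (Oint p).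
by case: k => [[|m]|m] [_ h hV] //; have := pos m; rewrite ?NegzE// in h hV *.
Qed.

Lemma vr_nat_exp (a : nat) : (0 < a)%N -> exists k : int, U (a%:R * pF ^ k).
Proof.
move=> a0; have [m cpm aE] := pfactor_coprime pp a0.
have m0 : (0 < m)%N by move: a0; rewrite {1}aE muln_gt0 => /andP[].
exists (- (logn p a)%:Z); rewrite {1}aE natrM natrX.
rewrite -exprnN mulfK ?expf_neq0//; exact: vr_unit_coprime.
Qed.

Lemma vr_rat_exp (r : rat) : r != 0 -> exists k : int, U (r%:A * pF ^ k).
Proof.
move=> r0; rewrite ratF_div.
have Uint (a : int) : a != 0 -> exists k : int, U (a%:~R * pF ^ k).
  move=> a0; have [|k Uk] := @vr_nat_exp `|a|; first by rewrite absz_gt0.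
  exists k; have : (a%:~R : F) = (-1) ^+ (a < 0)%R * (`|a|%N)%:R.
    by rewrite {1}[a]intEsign rmorphM rmorph_sign.
  move=> ->; rewrite -mulrA; apply: (vr_unitM vO) => //; apply: (vr_unitX vO).
  by split; rewrite ?oppr_eq0 ?oner_neq0 ?invrN ?invr1//; exact: (subringN sO).
have n0 : numq r != 0 by rewrite numq_eq0.
have [k1 U1] := Uint _ n0; have [k2 U2] := Uint (denq r) (denq_neq0 r).
exists (k1 - k2); have := vr_unitM vO U1 (vr_unitV U2).
by rewrite expfzDr// -invr_expz invfM mulrACA.
Qed.

(** The powers 1, x, ..., x^n are linearly dependent over Q, so two nonzero terms of a relation have
    the same valuation. Then x^(i-j) is a rational number up to a unit, hence a power of p up to a
    unit. *)
Lemma vr_power_exp x : x != 0 ->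
  exists2 e : nat, (0 < e <= \dim {:F})%N & exists k : int, U (x ^+ e * pF ^ k).
Proof.
move=> x0; set n := \dim {:F}.
pose X := [tuple x ^+ i | i < n.+1].
have : ~~ free X.
  rewrite /free size_tuple neq_ltn; apply/orP; left.
  by rewrite ltnS; apply: dimvS; exact: subvf.
move=> /freeP /existsNP[k /not_implyP[kX /existsNP[i0 /eqP ki0]]].
have kA (r : rat) : (r%:A != 0 :> F) = (r != 0) by rewrite scaler_eq0 oner_eq0 orbF.
have [||i [j [ij ti tj Uij]]] := @vr_sum0_unit _ _ vO n.+1 (fun i => (k i)%:A * x ^+ i) i0.
- by rewrite mulf_neq0 ?kA// expf_neq0.
- rewrite -[RHS]kX; apply: eq_bigr => i _.
  by rewrite -tnth_nth tnth_mktuple -scalerAl mul1r.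
have {ti}ki : k i != 0 by apply: contraNneq ti => ->; rewrite scale0r mul0r.
have {tj}kj : k j != 0 by apply: contraNneq tj => ->; rewrite scale0r mul0r.
exists (i - j)%N; first by rewrite subn_gt0 ij /=; have := ltn_ord i; clear; lia.
have [l Ul] : exists l : int, U ((k i / k j)%:A * pF ^ l).
  by apply: vr_rat_exp; rewrite mulf_neq0// invr_eq0.
exists (- l); have := vr_unitM vO Uij (vr_unitV Ul).
have -> : (k i / k j)%:A = (k i)%:A / (k j)%:A :> F.
  by rewrite -[LHS]/(in_alg F _) fmorph_div.
congr (U _); rewrite -invr_expz.
have -> : x ^+ i = x ^+ (i - j) * x ^+ j by rewrite -exprD subnK// ltnW.
by field; rewrite !kA ki kj expf_neq0//= expfz_neq0.
Qed.

(** The exponent in [vr_power_exp] depends on x but is at most the degree, so the factorial serves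
    every x at once. The function [w] below is N times the valuation for which p has value 1. *)
Let N := (\dim {:F})`!.

Let wex x : exists w : int, x != 0 -> U (x ^+ N * pF ^ (- w)).
Proof.
have [->|x0] := eqVneq x 0; first by exists 0.
have [e /andP[e0 en] [k Uk]] := vr_power_exp x0.
have /dvdnP[m NE] : (e %| N)%N by apply: dvdn_fact; rewrite e0.
exists (- (k * m%:Z)) => _; rewrite opprK NE mulnC exprM.
by rewrite -exprz_exp -[(pF ^ k) ^ m]/((pF ^ k) ^+ m) -exprMn; exact: vr_unitX.
Qed.

Let w x : int := xget 0 [set w | x != 0 -> U (x ^+ N * pF ^ (- w))].

Let wP x : x != 0 -> U (x ^+ N * pF ^ (- w x)).
Proof.
move=> x0; rewrite /w; case: xgetP => [v -> h|h]; first exact: h.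
by have [v hv] := wex x; have := h v; case.
Qed.

Let w_uniq x (k : int) : x != 0 -> U (x ^+ N * pF ^ (- k)) -> w x = k.
Proof.
move=> x0 Uk; have := vr_unitM vO Uk (vr_unitV (wP x0)).
have -> : x ^+ N * pF ^ (- k) * (x ^+ N * pF ^ (- w x))^-1 = pF ^ (w x - k).
  rewrite expfzDr// -!invr_expz invfM invrK mulrACA mulfV ?expf_neq0// mul1r.
  by rewrite mulrC.
by move=> /vr_unit_exp /eqP; rewrite subr_eq0 => /eqP.
Qed.

Let wM x y : x != 0 -> y != 0 -> w (x * y) = w x + w y.
Proof.
move=> x0 y0; apply: w_uniq; first exact: mulf_neq0.
rewrite exprMn opprD expfzDr// mulrACA.
by apply: (vr_unitM vO); exact: wP.
Qed.

Let w1 : w 1 = 0.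
Proof. by apply: w_uniq; rewrite ?oner_neq0// expr1n mul1r; split; rewrite ?invr1//= oner_neq0. Qed.

Let wV x : x != 0 -> w x^-1 = - w x.
Proof.
move=> x0; apply/eqP; rewrite -addr_eq0 -wM ?invr_eq0// mulVf//; exact/eqP.
Qed.

Let wX x (k : int) : x != 0 -> w (x ^ k) = k * w x.
Proof.
move=> x0; have h (m : nat) : w (x ^+ m) = m%:Z * w x.
  elim: m => [|m ih]; first by rewrite expr0 w1 mul0r.
  by rewrite exprS wM ?expf_neq0// ih intS mulrDl mul1r.
case: k => m; first exact: h.
by rewrite NegzE -exprnN wV ?expf_neq0// h mulNr.
Qed.

Let wp : w pF = N%:Z.
Proof.
apply: w_uniq => //; rewrite -exprnN mulfV ?expf_neq0//.
by split; rewrite ?invr1//= oner_neq0.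
Qed.

Let N0 : (0 < N)%N. Proof. exact: fact_gt0. Qed.

Let w_ge0 x : x != 0 -> O x <-> 0 <= w x.
Proof.
move=> x0; have [xN0 h hV] := wP x0.
have Op (m : nat) : O (pF ^+ m) by apply: subringX => //; exact: (Oint p).
split=> [ox|w0].
  rewrite leNgt; apply/negP => wn; apply: pV.
  have : O (x ^+ N * pF ^+ `|w x|.-1 / (x ^+ N * pF ^ (- w x))).
    by apply: OM => //; apply: OM => //; exact: subringX.
  move: wn h hV xN0; case: (w x) => // m _ _ _ xN0; rewrite NegzE opprK /= => h.
  suff -> : pF^-1 = x ^+ N * pF ^+ m / (x ^+ N * pF ^ m.+1) by [].
  have xN : x ^+ N != 0 by exact: expf_neq0.
  rewrite -[pF ^ m.+1]/(pF ^+ m.+1) exprS; move: (x ^+ N) xN => a a0.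
  have : pF ^+ m != 0 by exact: expf_neq0.
  by move: (pF ^+ m) => b b0; field; rewrite a0 b0 p0.
case: (proj2 vO x) => // xV.
have xO : O (x ^+ N).
  have -> : x ^+ N = x ^+ N * pF ^ (- w x) * pF ^ w x by rewrite -mulrA -expfzDr// addNr expr0z mulr1.
  by apply: OM => //; move: w0; case: (w x) => // m _; exact: Op.
(* In the remaining case x^N and x^-1 are known to lie in [O], and x is a product of their
   powers. *)
have -> : x = x ^+ N * x^-1 ^+ N.-1.
  by rewrite -{1}(prednK N0) exprS exprVn mulfK// expf_neq0.
by apply: OM => //; exact: subringX.
Qed.

(** Positive values of [w] exist because w p = N. By Euclidean division the least one generates the
    value group, so dividing [w] by it gives a normalised valuation. *)
Let dex : exists d : nat, (0 < d)%N && `[< exists2 x, x != 0 & w x = d%:Z >].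
Proof. by exists N; rewrite N0; apply/asboolP; exists pF. Qed.

Let d := ex_minn dex.

Let dP : exists x, [/\ x != 0, w x = d%:Z & forall y, y != 0 -> exists k : int, w y = k * d%:Z].
Proof.
rewrite /d; case: ex_minnP => m /andP[m0 /asboolP[x x0 wx]] mmin.
exists x; split=> // y y0; exists (w y %/ m)%Z.
have yx0 : y * x ^ (- (w y %/ m)%Z) != 0 by rewrite mulf_neq0// expfz_neq0.
have : w (y * x ^ (- (w y %/ m)%Z)) = (w y %% m)%Z.
  by rewrite wM ?expfz_neq0// wX// wx mulNr.
have mz : m%:Z != 0 by rewrite eqz_nat -lt0n.
have := modz_ge0 (w y) mz; have : (w y %% m)%Z < m by apply: ltz_pmod; rewrite ltz_nat.
have := divz_eq (w y) m.
case: (w y %% m)%Z => // -[|r] e rm _ h; first by rewrite {1}e addr0.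
have : (m <= r.+1)%N.
  apply: mmin; rewrite /=; apply/asboolP.
  by exists (y * x ^ (- (w y %/ m)%Z)).
by rewrite leqNgt -ltz_nat rm.
Qed.

Lemma vr_dvaluation_of_prime :
  exists v : dvaluation F, forall x, x != 0 -> O x <-> 0 <= v x.
Proof.
have [x1 [x10 wx1 wk]] := dP.
have d0 : 0 < d%:Z.
  by rewrite /d; case: ex_minnP => m /andP[m0 _] _; rewrite ltz_nat.
have d0' : d%:Z != 0 by rewrite gt_eqF.
pose v x : int := if x == 0 then 0 else (w x %/ d)%Z.
have vE x : x != 0 -> v x * d%:Z = w x.
  move=> x0; rewrite /v (negbTE x0); have [k ->] := wk _ x0.
  by rewrite mulzK.
have v0 : v 0 = 0 by rewrite /v eqxx.
have vM x y : x != 0 -> y != 0 -> v (x * y) = v x + v y.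
  move=> x0 y0; apply: (mulIf d0'); rewrite mulrDl !vE ?mulf_neq0//; exact: wM.
have vO' x : x != 0 -> O x <-> 0 <= v x.
  by move=> x0; rewrite -(pmulr_lge0 _ d0) vE//; exact: w_ge0.
have vD x y : x != 0 -> y != 0 -> x + y != 0 -> Num.min (v x) (v y) <= v (x + y).
  (* When v a <= v b, the quotient b/a is in [O] and so is 1 + b/a: the ultrametric inequality is
     the closure of [O] under addition. *)
  have main a b : a != 0 -> b != 0 -> a + b != 0 -> v a <= v b -> v a <= v (a + b).
    move=> a0 b0 ab0 le; have q0 : b / a != 0 by rewrite mulf_neq0// invr_eq0.
    have aE : a + b = a * (1 + b / a) by rewrite mulrDr mulr1 mulrC divfK.
    have q10 : 1 + b / a != 0 by apply: contraNneq ab0 => e; rewrite aE e mulr0.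
    rewrite aE vM// lerDl; apply/vO' => //; apply: (subringD sO) => //.
    by apply/vO' => //; have := vM _ _ q0 a0; rewrite divfK// => vb; rewrite -(lerD2r (v a)) add0r -vb.
  move=> x0 y0 xy0; case: (leP (v x) (v y)) => [|/ltW] h; first exact: main.
  by rewrite addrC; apply: main => //; rewrite addrC.
have von : exists2 x, x != 0 & v x = 1.
  by exists x1 => //; apply: (mulIf d0'); rewrite vE// mul1r.
by exists (DValuation v0 vM vD von).
Qed.

End Prime.

Lemma vr_dvaluation : exists v : dvaluation F, forall x, x != 0 -> O x <-> 0 <= v x.
Proof. by have [p pp pV] := vr_prime; exact: vr_dvaluation_of_prime pV. Qed.

End DiscreteValuationRing.

(* The ring Z[1/y] does not contain y when y is not an algebraic integer; a
   valuation ring avoiding y then gives a place where y is not integral. *)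
Lemma integral_of_vge (F : fieldExtType rat) (y : F) :
  (forall v : dvaluation F, vge v 0 y) ->
  exists N (a : nat -> int), y ^+ N = \sum_(i < N) (a i)%:~R * y ^+ i.
Proof.
move=> vy; have [->|y0] := eqVneq y 0.
  by exists 1%N, (fun=> 0); rewrite big_ord1 mul0r expr1.
pose A0 : set F := [set x | exists p : {poly int}, x = (map_poly intr p).[y^-1]].
have sA0 : subring_set A0.
  split; first by exists 1; rewrite rmorph1 hornerC.
  - by move=> _ _ [p ->] [q ->]; exists (p - q); rewrite rmorphB hornerD hornerN.
  - by move=> _ _ [p ->] [q ->]; exists (p * q); rewrite rmorphM hornerM.
have yV0 : y^-1 != 0 by rewrite invr_eq0.
have [[p yE]|yA0] := pselect (A0 y).
  (* Here y is an integer polynomial in y^-1. Multiplying by y^(size p - 1) gives a monic equation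
     of degree [size p], with the coefficients reversed. *)
  exists (size p), (fun i => p`_(size p - i.+1)).
  have sp : (0 < size p)%N.
    rewrite lt0n size_poly_eq0; apply: contraNneq y0 => p0.
    by rewrite yE p0 rmorph0 horner0.
  have -> : y ^+ size p = y * y ^+ (size p).-1 by rewrite -exprS prednK.
  rewrite {1}yE (@horner_coef_wide _ (size p)) ?size_poly// mulr_suml.
  rewrite (reindex_inj rev_ord_inj); apply: eq_bigr => i _ /=.
  rewrite coef_map -mulrA; congr (_ * _); rewrite exprVn.
  have -> : y ^+ (size p).-1 = y ^+ (size p - i.+1) * y ^+ i.
    by rewrite -exprD; congr (_ ^+ _); have := ltn_ord i; clear; lia.
  by rewrite mulKf// expf_neq0.
have [||O [vO OyV Oy]] := @valuation_ring_avoiding F y^-1 A0 yV0 sA0.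
- by exists 'X; rewrite map_polyX hornerX.
- by rewrite invrK.
rewrite invrK in Oy.
have [|v hv] := @vr_dvaluation F O vO; first by exists y.
by exfalso; apply: Oy; apply/hv => //; exact: vge_val (vy v).
Qed.

(** * Real embeddings *)

Lemma rmorphism_ext (A B : pzSemiRingType) (f g : {rmorphism A -> B}) :
  f =1 g -> f = g.
Proof.
case: f g => [f [[fD] [fM]]] [g [[gD] [gM]]] /= fg.
have {}fg : f = g by exact/funext.
by subst g; rewrite (Prop_irrelevance fD gD) (Prop_irrelevance fM gM).
Qed.

Lemma rmorphism_of (A B : pzRingType) (f : A -> B) :
  zmod_morphism f -> monoid_morphism f -> exists g : {rmorphism A -> B}, g =1 f.
Proof.
move=> fB fM.
pose g := HB.pack_for {rmorphism A -> B} f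
  (GRing.isZmodMorphism.Build A B f fB) (GRing.isMonoidMorphism.Build A B f fM).
by exists g.
Qed.

Lemma pchar0_fieldExt_rat (F : fieldExtType rat) : [pchar F] =i pred0.
Proof. by move=> p; rewrite pchar_lalg pchar_num. Qed.

Section PrimitiveElement.
Local Open Scope complex_scope.
Variable F : fieldExtType rat.
Local Notation iF := (map_poly (in_alg F)).

Lemma rat_primitive_element : exists (th : F) (P : {poly rat}),
  [/\ P != 0, separable_poly P, forall g, (iF g).[th] = 0 <-> P %| g
    & forall x, exists g, x = (iF g).[th]].
Proof.
have sep : separable 1%AS {:F}%AS.
  by apply/separableP => y _; apply: pcharf0_separable; exact: pchar0_fieldExt_rat.
have := eq_adjoin_separable_generator sep (sub1v _).
set th := separable_generator _ _ => Fth; exists th.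
have /polyOver1P[P PE] := minPolyOver 1 th; exists P.
split.
- by rewrite -(map_poly_eq0 (in_alg F)) -PE monic_neq0// monic_minPoly.
- have := @pcharf0_separable _ _ 1%AS (@pchar0_fieldExt_rat F) th.
  by rewrite /separable_element PE separable_map.
- move=> g; split=> [g0|/dvdpP[q ->]].
    rewrite -(dvdp_map (in_alg F)) -PE; apply: minPoly_dvdp; last exact/rootP.
    by apply/polyOver1P; exists g.
  by rewrite rmorphM /= hornerM -PE minPolyxx mulr0.
- move=> x; have xth : x \in <<1; th>>%VS by rewrite -Fth memvf.
  have /polyOver1P[g gE] := Fadjoin_polyOver 1 th x.
  by exists g; rewrite -gE Fadjoin_poly_eq.
Qed.

(** [F] is Q[X]/(P). A representative [G x] is chosen for each x, and [key] says that its value at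
    the root [al] does not depend on the choice. *)
Lemma root_rmorphism (L : fieldType) (iL : {rmorphism rat -> L}) (th : F)
    (P : {poly rat}) (al : L) :
  (forall g, (iF g).[th] = 0 <-> P %| g) ->
  (forall x, exists g, x = (iF g).[th]) -> root (map_poly iL P) al ->
  exists f : {rmorphism F -> L}, f th = al.
Proof.
move=> gP Fg /rootP Pal.
have /choice[G GE] := Fg.
have key g h : (iF g).[th] = (iF h).[th] -> (map_poly iL g).[al] = (map_poly iL h).[al].
  move=> gh; have : (iF (g - h)).[th] = 0 by rewrite rmorphB hornerD hornerN gh subrr.
  move=> /gP/dvdpP[q qE]; apply/eqP; rewrite -subr_eq0 -hornerN -hornerD -rmorphB qE.
  by rewrite rmorphM hornerM Pal mulr0.
have [||f fE] := @rmorphism_of F L (fun x => (map_poly iL (G x)).[al]).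
- move=> x y; rewrite -hornerN -hornerD -rmorphB; apply: key.
  by rewrite -GE rmorphB hornerD hornerN -!GE.
- split.
    have := @key (G 1) 1; rewrite -GE !rmorph1 !hornerC; exact.
  by move=> x y; rewrite -hornerM -rmorphM; apply: key; rewrite -GE rmorphM hornerM -!GE.
exists f; rewrite fE; have := @key (G th) 'X.
by rewrite -GE !map_polyX !hornerX; exact.
Qed.

Lemma rmorph_primitive (L : fieldType) (f : {rmorphism F -> L}) (th : F) (g : {poly rat}) :
  f (iF g).[th] = (map_poly ratr g).[f th].
Proof.
rewrite -horner_map -map_poly_comp; congr (_.[_]); apply: eq_map_poly => r /=.
exact: (fmorph_eq_rat (f \o in_alg F)).
Qed.

Variable R : realType.
Hypothesis F_real : totally_real R F.

(** The basis consists of powers of a primitive element, with one embedding for each complex root of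
    its minimal polynomial; these are real by [F_real]. The matrix is a transposed Vandermonde
    matrix with distinct nodes. *)
Lemma real_embedding_basis : exists (n : nat) (b : 'I_n -> F) (sg : 'I_n -> real_place R F),
  [/\ forall y, exists c : 'I_n -> rat, y = \sum_j (c j)%:A * b j,
      injective sg, forall s, exists i, s = sg i
    & (\matrix_(i, j) (sg i : {rmorphism F -> R}) (b j)) \in unitmx].
Proof.
have [th [P [P0 Psep gP Fg]]] := rat_primitive_element.
have [r rE] := closed_field_poly_normal (map_poly (ratr : rat -> R[i]) P).
have lc0 : lead_coef (map_poly (ratr : rat -> R[i]) P) != 0.
  by rewrite lead_coef_eq0 map_poly_eq0.
have ur : uniq r.
  rewrite -separable_prod_XsubC.
  have : separable_poly (map_poly (ratr : rat -> R[i]) P) by rewrite separable_map.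
  by rewrite rE (eqp_separable (eqp_scale _ lc0)).
have sr : size P = (size r).+1.
  by rewrite -(size_map_poly (ratr : rat -> R[i])) rE size_scale// size_prod_XsubC.
set n := size r in sr *.
have rootr z : z \in r -> root (map_poly (ratr : rat -> R[i]) P) z.
  by move=> zr; rewrite rE rootZ// root_prod_XsubC.
have /choice[sg sgE] (i : 'I_n) : exists s : real_place R F,
    ((s : {rmorphism F -> R}) th)%:C = r`_i.
  have [f fE] := root_rmorphism gP Fg (rootr _ (mem_nth 0 (ltn_ord i))).
  have fR x : f x = (complex.Re (f x))%:C.
    by have := F_real f x; case: (f x) => a b /= ->.
  have [||s sE] := @rmorphism_of F R (fun x => complex.Re (f x)).
  - by move=> x y; rewrite rmorphB; case: (f x) (f y) => [a b] [].
  - split; first by rewrite rmorph1.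
    by move=> x y; rewrite rmorphM (fR x) (fR y) /= mul0r subr0.
  by exists s; rewrite sE -fR.
have sgI : injective sg.
  move=> i j e; apply/val_inj/eqP; rewrite /= -(nth_uniq 0 (ltn_ord i) (ltn_ord j) ur).
  by rewrite -!sgE e.
exists n, (fun j => th ^+ j), sg; split=> //.
- move=> y; have [g ->] := Fg y; exists (fun j => (g %% P)`_j).
  have -> : (iF g).[th] = (iF (g %% P)).[th].
    apply/eqP; rewrite -subr_eq0 -hornerN -hornerD -rmorphB; apply/eqP/gP.
    by rewrite {1}(divp_eq g P) addrK dvdp_mull.
  rewrite (@horner_coef_wide _ n); last by rewrite size_map_poly -ltnS -sr ltn_modp.
  by apply: eq_bigr => i _; rewrite coef_map.
- move=> s; have : ((s : {rmorphism F -> R}) th)%:C \in r.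
    rewrite -root_prod_XsubC -(rootZ _ _ lc0) -rE; apply/rootP.
    have e : (iF P).[th] = 0 by exact/gP.
    have := rmorph_primitive (s : {rmorphism F -> R}) th P; rewrite e rmorph0.
    move=> /(congr1 (fun x : R => x%:C)); rewrite rmorph0 -horner_map -map_poly_comp => ->.
    congr (_.[_]); apply: eq_map_poly => x /=; exact/esym/fmorph_rat.
  move=> /(nthP 0)[i ir ri]; exists (Ordinal ir).
  have {}ri : (s : {rmorphism F -> R}) th = (sg (Ordinal ir) : {rmorphism F -> R}) th.
    by apply: (@complexI R); rewrite sgE ri.
  apply: rmorphism_ext => x; have [g ->] := Fg x.
  by rewrite !rmorph_primitive ri.
- have -> : \matrix_(i, j) (sg i : {rmorphism F -> R}) (th ^+ j) =
      (Vandermonde n (\row_i (sg i : {rmorphism F -> R}) th))^T.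
    by apply/matrixP => i j; rewrite !mxE rmorphXn.
  rewrite unitmx_tr unitmxE det_Vandermonde unitfE.
  apply/prodf_neq0 => i _; apply/prodf_neq0 => j ij; rewrite !mxE subr_eq0.
  apply/eqP => e; have : r`_j = r`_i by rewrite -!sgE e.
  by move=> /eqP; rewrite nth_uniq// gtn_eqF.
Qed.

End PrimitiveElement.

(** * Counting lattice points *)

Lemma expr_small (R : realType) (q C e : R) : 0 <= q < 1 -> 0 < e ->
  \forall k \near \oo, C * q ^+ k < e.
Proof.
move=> /andP[q0 q1] e0.
have qc : (C * q ^+ k) @[k --> \oo] --> C * 0.
  by apply: cvgMr; apply: cvg_expr; rewrite ger0_norm.
rewrite mulr0 in qc; near=> k.
apply: le_lt_trans (ler_norm _) _.
by near: k; exact: cvgr0_norm_lt qc e e0.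
Unshelve. all: by end_near. Qed.

(** High powers absorb the unknown constant [C]; both counting arguments end this way. *)
Lemma exp_growth (R : realType) (a b C : R) : 0 < b -> 0 <= a ->
  (forall k, a ^+ k <= C * b ^+ k) -> a <= b.
Proof.
move=> b0 a0 h; rewrite leNgt; apply/negP => ba.
have {}a0 : 0 < a := lt_trans b0 ba.
have [|k hk] := filter_ex (@expr_small R (b / a) C 1 _ ltr01).
  by rewrite divr_ge0 ?ltW//= ltr_pdivrMr ?mul1r.
have := h k; rewrite leNgt => /negP; apply.
by move: hk; rewrite expr_div_n mulrA ltr_pdivrMr ?exprn_gt0// mul1r.
Qed.

Lemma common_multiple (T : finType) (P : T -> nat -> Prop) :
  (forall t, exists2 d, (0 < d)%N & P t d) ->
  (forall t d m, P t d -> P t (m * d)%N) ->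
  exists2 d, (0 < d)%N & forall t, P t d.
Proof.
move=> h PM; have /choice[d hd] t : exists d, (0 < d)%N /\ P t d.
  by have [d d0 Pd] := h t; exists d.
exists (\prod_t d t)%N; first by apply: prodn_gt0 => t; case: (hd t).
by move=> t; rewrite (bigD1 t)//= mulnC; apply: PM; case: (hd t).
Qed.

Lemma common_denominator (n : nat) (c : 'I_n -> rat) :
  exists2 d, (0 < d)%N & forall j, exists z : int, d%:R * c j = z%:~R.
Proof.
apply: common_multiple => [j|j d m [z hz]]; last first.
  by exists (m%:Z * z); rewrite natrM -mulrA hz intrM.
exists `|denq (c j)|%N; first by rewrite absz_gt0 denq_neq0.
exists (numq (c j)); rewrite -{2}[c j]divq_num_den.
have -> : (`|denq (c j)|%N)%:R = (denq (c j))%:~R :> rat.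
  by rewrite -[in RHS](gez0_abs (denq_ge0 (c j))).
by rewrite mulrC divfK// intr_eq0 denq_neq0.
Qed.

Section Lattice.
Variables (R : realType) (F : fieldExtType rat) (n : nat).
Variables (b : 'I_n -> F) (sg : 'I_n -> {rmorphism F -> R}).
Hypothesis gen : forall y, exists c : 'I_n -> rat, y = \sum_j (c j)%:A * b j.
Hypothesis embU : (\matrix_(i, j) sg i (b j)) \in unitmx.
Implicit Types x y z : F.

Definition lattice : set F :=
  [set y | exists c : 'I_n -> int, y = \sum_j (c j)%:~R * b j].

Lemma latticeD x y : lattice x -> lattice y -> lattice (x + y).
Proof.
move=> [c ->] [c' ->]; exists (fun j => c j + c' j).
by rewrite -big_split; apply: eq_bigr => j _ /=; rewrite intrD mulrDl.
Qed.

Lemma latticeZ (m : int) x : lattice x -> lattice (m%:~R * x).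
Proof.
move=> [c ->]; exists (fun j => m * c j).
by rewrite mulr_sumr; apply: eq_bigr => j _; rewrite intrM mulrA.
Qed.

Lemma latticeMn (m : nat) x : lattice x -> lattice (m%:R * x).
Proof. exact: (latticeZ m). Qed.

Lemma latticeB x y : lattice x -> lattice y -> lattice (x - y).
Proof.
move=> Lx Ly; apply: latticeD => //.
by rewrite -mulN1r; exact: (@latticeZ (-1)).
Qed.

Lemma lattice_sum (I : Type) (r : seq I) (P : pred I) (f : I -> F) :
  (forall i, P i -> lattice (f i)) -> lattice (\sum_(i <- r | P i) f i).
Proof.
move=> h; apply: big_ind => //; last exact: latticeD.
by exists (fun=> 0); rewrite big1// => j _; rewrite mul0r.
Qed.

Lemma lattice_denominator y : exists2 d, (0 < d)%N & lattice (d%:R * y).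
Proof.
have [c yE] := gen y; have [d d0 /choice[z hz]] := common_denominator c.
exists d => //; exists z; rewrite yE mulr_sumr; apply: eq_bigr => j _.
rewrite mulrA; congr (_ * _).
have -> : (z j)%:~R = (z j)%:~R%:A :> F by rewrite scaler_int.
by rewrite -hz -[RHS]/(in_alg F _) rmorphM rmorph_nat.
Qed.

Definition integral_eq x : Prop :=
  exists N (a : nat -> int), x ^+ N = \sum_(i < N) (a i)%:~R * x ^+ i.

(** One [d] works for all k: denominators for k < N suffice, since the monic equation expresses
    higher powers of x through lower ones with integer coefficients. *)
Lemma integral_denominator x y : integral_eq x ->
  exists2 d, (0 < d)%N & forall k, lattice (d%:R * (x ^+ k * y)).
Proof.
move=> [N [a xN]].
have N0 : (0 < N)%N.
  by case: N xN => // /eqP; rewrite big_ord0 expr0 oner_eq0.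
have [||d d0 hd] := @common_multiple 'I_N (fun i d => lattice (d%:R * (x ^+ i * y))).
- by move=> i; exact: lattice_denominator.
- by move=> i d m h; rewrite natrM -mulrA; exact: latticeMn.
exists d => //; elim/ltn_ind => k ih; have [kN|Nk] := ltnP k N.
  exact: (hd (Ordinal kN)).
rewrite -(subnK Nk) exprD xN -(mulrA (x ^+ (k - N))) mulr_suml !mulr_sumr.
apply: lattice_sum => i _.
have -> : d%:R * (x ^+ (k - N) * ((a i)%:~R * x ^+ i * y)) =
    (a i)%:~R * (d%:R * (x ^+ (k - N + i) * y)) by rewrite exprD; ring.
by apply: latticeZ; apply: ih; have := ltn_ord i; move: Nk; clear; lia.
Qed.

Lemma emb_sum i (c : 'I_n -> int) :
  sg i (\sum_j (c j)%:~R * b j) = \sum_j (c j)%:~R * sg i (b j).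
Proof. by rewrite rmorph_sum; apply: eq_bigr => j _; rewrite rmorphM rmorph_int. Qed.

Lemma emb_lattice_inj (c : 'I_n -> int) j :
  (c j)%:~R = \sum_i invmx (\matrix_(i, j) sg i (b j)) j i *
                sg i (\sum_j (c j)%:~R * b j) :> R.
Proof.
have VU := embU; set V := (\matrix_(i, j) _) in VU *.
pose w : 'cV[R]_n := \col_j (c j)%:~R.
have e : invmx V *m (V *m w) = w by rewrite mulKmx.
have := congr1 (fun M : 'cV[R]_n => M j 0) e; rewrite !mxE => <-.
apply: eq_bigr => i _; rewrite emb_sum !mxE; congr (_ * _).
by apply: eq_bigr => k _; rewrite !mxE mulrC.
Qed.

(** The inverse matrix recovers the integer coordinates from the conjugates, so conjugates below 1/B
    force coordinates below 1 in absolute value. The summand 1 in [B] keeps the bound within (0, 1],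
    as the digit count requires. *)
Lemma lattice_discrete : exists2 d : R, 0 < d <= 1 &
  forall y, lattice y -> (forall i, `|sg i y| < d) -> y = 0.
Proof.
set W := invmx (\matrix_(i, j) sg i (b j)).
pose B := 1 + \sum_j \sum_i `|W j i|.
have B1 : 1 <= B by rewrite lerDl sumr_ge0// => j _; exact: sumr_ge0.
have B0 : 0 < B := lt_le_trans ltr01 B1.
exists B^-1; first by rewrite invr_gt0 B0 invf_le1.
move=> _ [c ->] h; rewrite big1// => j _.
suff -> : c j = 0 by rewrite mul0r.
have : `|(c j)%:~R : R| < 1.
  rewrite emb_lattice_inj -/W; apply: le_lt_trans (ler_norm_sum _ _ _) _.
  apply: (@le_lt_trans _ _ ((\sum_i `|W j i|) * B^-1)).
    rewrite mulr_suml; apply: ler_sum => i _; rewrite normrM ler_wpM2l//; exact/ltW.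
  rewrite ltr_pdivrMr// mul1r /B [X in _ < _ + X](bigD1 j)//= addrCA ltrDl.
  by rewrite ltr_pwDl// sumr_ge0// => k _; exact: sumr_ge0.
by rewrite -intr_norm ltrz1 -[1]/(1%:Z) => h1; apply/eqP; rewrite -normr_eq0; lia.
Qed.

(** The powers of z share a denominator d, so d z^k stays in the lattice while its conjugates tend
    to 0; by discreteness it vanishes for large k. *)
Lemma integral_small_eq0 z : integral_eq z -> (forall i, `|sg i z| < 1) -> z = 0.
Proof.
move=> iz sz; have [d d0 hd] := @integral_denominator z 1 iz.
have [e /andP[e0 _] he] := lattice_discrete.
have [k hk] : exists k, forall i, d%:R * `|sg i z| ^+ k < e.
  suff /filter_ex : \forall k \near \oo, forall i, d%:R * `|sg i z| ^+ k < e by [].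
  by apply: filter_forall => i; apply: expr_small => //; rewrite normr_ge0 sz.
have /eqP : d%:R * (z ^+ k * 1) = 0.
  apply: he; first exact: hd.
  by move=> i; rewrite mulr1 rmorphM rmorphXn rmorph_nat normrM normr_nat normrX.
by rewrite mulr1 mulf_eq0 expf_eq0 (negbTE (natF_neq0 F d0)) => /andP[_ /eqP].
Qed.

End Lattice.

Section Counting.
Variables (R : realType) (F : fieldExtType rat) (n : nat).
Variables (b : 'I_n -> F) (sg : 'I_n -> {rmorphism F -> R}).
Hypothesis gen : forall y, exists c : 'I_n -> rat, y = \sum_j (c j)%:A * b j.
Hypothesis embU : (\matrix_(i, j) sg i (b j)) \in unitmx.
Implicit Types x y z : F.

Local Notation lattice := (lattice b).

Lemma finite_bound (T : finType) (f : T -> R) : exists2 Y, 1 <= Y & forall t, f t <= Y.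
Proof.
exists (1 + \sum_t `|f t|) => [|t]; first by rewrite lerDl sumr_ge0.
rewrite (bigD1 t)//= addrCA; apply: le_trans (ler_norm _) _.
by rewrite lerDl addr_ge0// sumr_ge0.
Qed.

Lemma card_box (m : 'I_n -> nat) :
  #|{dffun forall i : 'I_n, 'I_(m i)}| = (\prod_i m i)%N.
Proof.
by rewrite card_dep_ffun foldrE big_image /=; apply: eq_bigr => i _; rewrite card_ord.
Qed.

(* Expanding in base x, the digits y t produce #|T|^k distinct points of a fixed
   lattice in a box of volume O(prod_i |sg_i x|^k). *)
Lemma digits_bound (T : finType) (y : T -> F) (S : set (dvaluation F)) x :
  integral_eq x -> x != 0 -> (forall i, 2 <= `|sg i x|) ->
  (forall v t, S v -> vge v 0 (y t)) ->
  (forall t t', t != t' -> exists2 v, S v & ~ vge v (v x) (y t - y t')) ->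
  (forall v, S v -> 0 <= v x) ->
  #|T|%:R <= \prod_i `|sg i x|.
Proof.
move=> ix x0 x2 yS ysep vx.
(* Horner evaluation at x; the head of the list is the lowest digit. *)
pose ev := foldr (fun t acc => y t + x * acc) 0.
have evS s v : S v -> vge v 0 (ev s).
  move=> Sv; elim: s => [|t s ih] /=; first exact: vge0.
  apply: vgeD; first exact: yS.
  by rewrite -[0]addr0; apply: vgeM => //; right; exact: vx.
(* Reduction modulo x at the places of [S] reads off the lowest digit; the other digits follow after
   division by x. *)
have evI s s' : size s = size s' -> ev s = ev s' -> s = s'.
  elim: s s' => [|t s ih] [|t' s']//= [ss] e.
  have [tt|tt] := eqVneq t t'.
    rewrite tt in e *; congr (_ :: _); apply: ih => //.
    by apply: (mulfI x0); exact: addrI e.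
  have [v Sv []] := ysep _ _ tt.
  have -> : y t - y t' = x * (ev s' - ev s).
    by rewrite mulrBr; apply/eqP; rewrite subr_eq addrAC eq_sym subr_eq addrC -/(ev s) e addrC.
  rewrite -[v x]addr0; apply: vgeM; first by right.
  by apply: vgeD; [exact: evS|apply: vgeN; exact: evS].
have [||d d0 hd] := @common_multiple T (fun t d => forall k, lattice (d%:R * (x ^+ k * y t))).
- by move=> t; exact: (integral_denominator gen).
- by move=> t d m h k; rewrite natrM -mulrA; exact: latticeMn.
have evL s : lattice (d%:R * ev s).
  suff h k : lattice (d%:R * (x ^+ k * ev s)) by have := h 0%N; rewrite expr0 mul1r.
  elim: s k => [|t s ih] k /=.
    by rewrite !mulr0; exists (fun=> 0); rewrite big1// => j _; rewrite mul0r.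
  rewrite mulrDr mulrDr; apply: latticeD => //.
  by rewrite (mulrA (x ^+ k)) -exprSr.
have [Y Y1 hY] : exists2 Y, 1 <= Y & forall i t, `|sg i (y t)| <= Y.
  have [Y Y1 hY] := @finite_bound ('I_n * T)%type (fun p => `|sg p.1 (y p.2)|).
  by exists Y => // i t; exact: (hY (i, t)).
have Y0 : 0 <= Y := le_trans ler01 Y1.
(* The subtracted 1 lets the induction close: Y + aY(a^k - 1) <= Y(a^(k+1) - 1) amounts to a >=
   2. *)
have evB i s : `|sg i (ev s)| <= Y * (`|sg i x| ^+ size s - 1).
  elim: s => [|t s ih] /=; first by rewrite rmorph0 normr0 expr0 subrr mulr0.
  rewrite rmorphD rmorphM; apply: le_trans (ler_normD _ _) _; rewrite normrM.
  have h1 : `|sg i x| * `|sg i (ev s)| <= `|sg i x| * (Y * (`|sg i x| ^+ size s - 1)) by rewrite ler_wpM2l.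
  apply: le_trans (lerD (hY i t) h1) _; rewrite exprS.
  have := x2 i; move: (`|sg i x|) => a a2.
  by rewrite -subr_ge0 (_ : _ - _ = Y * (a - 2)); [rewrite mulr_ge0// subr_ge0|ring].
have [e /andP[e0 e1] he] := lattice_discrete embU.
have dR : 1 <= d%:R :> R by rewrite ler1n.
pose B k i : R := d%:R * Y / e * `|sg i x| ^+ k.
have B1 k i : 1 <= B k i.
  rewrite /B mulr_ege1//; last by rewrite exprn_ege1// (le_trans _ (x2 i))// ler1n.
  by rewrite ler_pdivlMr// mul1r (le_trans e1)// mulr_ege1.
have B0 k i : 0 <= B k i := le_trans ler01 (B1 k i).
have evBB k i (s : k.-tuple T) : `|sg i (d%:R * ev s) / e| <= B k i.
  rewrite normrM normfV (gtr0_norm e0) rmorphM rmorph_nat normrM normr_nat /B.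
  have -> : d%:R * Y / e * `|sg i x| ^+ k = d%:R * (Y * `|sg i x| ^+ k) / e by ring.
  rewrite ler_pM2r ?invr_gt0// ler_wpM2l//.
  apply: le_trans (evB i s) _; rewrite size_tuple ler_wpM2l//.
  by rewrite gerBl.
(* Each conjugate is measured in cells of width [e] and shifted by [B] to be nonnegative. Two points
   in the same cell for every embedding have all conjugates of their difference below [e], so they
   coincide. *)
pose cell k (s : k.-tuple T) i : R := sg i (d%:R * ev s) / e + B k i.
have cell0 k s i : 0 <= @cell k s i.
  by rewrite /cell -lerBlDr sub0r; have /ler_normlP[] := evBB k i s; rewrite lerNl.
have cellB k s i : (Num.truncn (@cell k s i) < (Num.truncn (2 * B k i)).+1)%N.
  rewrite ltnS le_truncn// /cell mulrDl mul1r lerD2r.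
  by have /ler_normlP[] := evBB k i s.
(* The 3 comes from the number of cells in one direction, at most 2B + 1 <= 3B because B >= 1. *)
apply: (@exp_growth R _ _ (\prod_(i < n) (3 * (d%:R * Y / e)))) => //.
  by apply: prodr_gt0 => i _; exact: lt_le_trans (x2 i).
move=> k.
pose f (s : k.-tuple T) : {dffun forall i : 'I_n, 'I_(Num.truncn (2 * B k i)).+1} :=
  [ffun i => Ordinal (cellB k s i)].
have fI : injective f.
  move=> s s' ff; apply: val_inj; apply: evI; first by rewrite !size_tuple.
  have dF := natF_neq0 F d0.
  apply: (mulfI dF); apply/eqP; rewrite -subr_eq0; apply/eqP.
  apply: he; first by apply: latticeB; exact: evL.
  move=> i; have tt : Num.truncn (cell k s i) = Num.truncn (cell k s' i).
    by move/ffunP: ff => /(_ i) /(congr1 val); rewrite !ffunE.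
  have /andP[l1 u1] := truncn_itv (cell0 k s i).
  have /andP[l2 u2] := truncn_itv (cell0 k s' i).
  rewrite tt -natr1 in l1 u1; rewrite -natr1 in u2.
  rewrite rmorphB; set u := sg i (_ * ev s); set u' := sg i (_ * ev s').
  rewrite -[X in _ < X]mul1r -ltr_pdivrMr// -[X in _ / X](gtr0_norm e0).
  rewrite -normfV -normrM mulrBl ltr_norml.
  by move: l1 u1 l2 u2; rewrite /cell -/u -/u' => *; apply/andP; split; lra.
have := leq_card f fI; rewrite card_tuple card_box -(ler_nat R) natrX => /le_trans; apply.
rewrite natr_prod -prodrXl -big_split /=.
apply: ler_prod => i _; rewrite ler0n /=.
have /andP[h _] := truncn_itv (mulr_ge0 (ler0n R 2) (B0 k i)).
have -> : 3 * (d%:R * Y / e) * `|sg i x| ^+ k = 3 * B k i by rewrite -mulrA.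
rewrite -natr1; apply: (@le_trans _ _ (2 * B k i + 1)); first by rewrite lerD2r.
by move: (B k i) (B1 k i) => q q1; lra.
Qed.

(** Points with coordinates between 0 and h fall into distinct classes: two in one class differ by m
    times an algebraic integer with all conjugates below 1, that is, by 0. *)
Lemma pigeonhole_bound : (forall j v, vge v 0 (b j)) ->
  exists2 C : R, 0 < C & forall (m : nat) (T : finType) (cls : F -> T), (0 < m)%N ->
  (forall y y', (forall v, vge v 0 y) -> (forall v, vge v 0 y') -> cls y = cls y' ->
     forall v : dvaluation F, vge v (v m%:R) (y - y')) ->
  m%:R ^+ n <= C * #|T|%:R.
Proof.
move=> bint.
pose S := \sum_i \sum_j `|sg i (b j)|.
have S0 : 0 <= S by apply: sumr_ge0 => i _; exact: sumr_ge0.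
have S1 : 0 < 1 + S by rewrite ltr_pwDl.
exists ((1 + S) ^+ n) => [|m T cls m0 hcls]; first exact: exprn_gt0.
have mR : 0 < m%:R :> R by rewrite ltr0n.
have mF := natF_neq0 F m0.
have mS0 : 0 <= m%:R / (1 + S) by rewrite divr_ge0 ?ltW.
(* As h <= m/(1+S), a difference of two points has conjugates at most S h < m; as h + 1 > m/(1+S),
   the (h+1)^n points yield the constant (1+S)^n. *)
pose h := Num.truncn (m%:R / (1 + S)).
have /andP[hl hu] := truncn_itv mS0; rewrite -/h in hl hu.
pose pt (c : {ffun 'I_n -> 'I_h.+1}) : F := \sum_j ((c j)%:Z)%:~R * b j.
have ptint c v : vge v 0 (pt c).
  apply: vge_sum => j _; rewrite -[0]addr0; apply: vgeM => //; exact: vge_int.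
have ptI : injective (cls \o pt).
  move=> c c' /= cc.
  have yy : pt c - pt c' = \sum_j ((c j)%:Z - (c' j)%:Z)%:~R * b j.
    by rewrite -sumrB; apply: eq_bigr => j _; rewrite intrB mulrBl.
  have z0 : (pt c - pt c') / m%:R = 0.
    apply: (integral_small_eq0 gen embU).
      apply: integral_of_vge => v; have := hcls _ _ (ptint c) (ptint c') cc v.
      have [->|d0] := eqVneq (pt c - pt c') 0; first by rewrite mul0r; left.
      move=> /(vge_val d0) h1; right.
      by rewrite dvalM ?invr_eq0// dvalV// subr_ge0.
    move=> i; rewrite yy rmorphM emb_sum.
    have -> : sg i (m%:R)^-1 = (m%:R)^-1 by rewrite fmorphV rmorph_nat.
    rewrite normrM normfV normr_nat ltr_pdivrMr// mul1r.
    apply: (@le_lt_trans _ _ (S * h%:R)); last first.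
      move: hl; rewrite ler_pdivlMr// mulrDr mulr1 mulrC.
      have [->|h0] := posnP h; first by rewrite mulr0.
      have : 0 < h%:R :> R by rewrite ltr0n.
      lra.
    apply: le_trans (ler_norm_sum _ _ _) _.
    apply: (@le_trans _ _ (\sum_j `|sg i (b j)| * h%:R)).
      apply: ler_sum => j _; rewrite normrM mulrC ler_wpM2l//.
      rewrite -intr_norm -[h%:R]/(h%:Z%:~R) ler_int.
      by have := ltn_ord (c j); have := ltn_ord (c' j); lia.
    rewrite -mulr_suml ler_wpM2r// /S [leRHS](bigD1 i)//= lerDl.
    by apply: sumr_ge0 => k _; exact: sumr_ge0.
  have {}z0 : pt c - pt c' = 0.
    by move/eqP: z0; rewrite mulf_eq0 invr_eq0 (negbTE mF) orbF => /eqP.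
  apply/ffunP => j; apply: val_inj => /=.
  have := emb_lattice_inj embU (fun j => (c j)%:Z - (c' j)%:Z) j; rewrite -yy z0.
  rewrite big1 => [/eqP|i _]; last by rewrite rmorph0 mulr0.
  by rewrite intr_eq0 subr_eq0 eqz_nat => /eqP.
have := leq_card _ ptI; rewrite card_ffun !card_ord -(ler_nat R) natrX => hT.
apply: (@le_trans _ _ ((1 + S) ^+ n * (h.+1)%:R ^+ n)); last first.
  by rewrite ler_wpM2l// exprn_ge0// ltW.
rewrite -exprMn lerXn2r ?nnegrE ?mulr_ge0 ?ltW//.
by rewrite mulrC -ltr_pdivrMr.
Qed.

End Counting.

(** * Residue systems *)

Section Residues.
Variables (R : realType) (F : fieldExtType rat).
Hypothesis F_real : totally_real R F.
Implicit Types (v w : dvaluation F) (x y : F).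

Lemma dval_valuation_ring v : valuation_ring (vge v 0).
Proof.
split; first split.
- by right; rewrite dval1.
- by move=> x y vx vy; apply: vgeD => //; exact: vgeN.
- by move=> x y vx vy; rewrite -[0]addr0; exact: vgeM.
move=> u; have [->|u0] := eqVneq u 0; first by left; left.
by have [h|/ltW h] := leP 0 (v u); [left|right]; right; rewrite ?dvalV// oppr_ge0.
Qed.

Lemma dval_prime v : exists2 p, prime p & 0 < v p%:R.
Proof.
have [x x0 vx] := dval_onto v.
have [|p pp vp] := vr_prime (dval_valuation_ring v).
  exists x^-1 => /vge_val; rewrite invr_eq0 => /(_ x0).
  by rewrite dvalV// vx.
exists p => //; rewrite ltNge; apply/negP => vp0; apply: vp; right.
by rewrite dvalV ?oppr_ge0// natF_neq0// prime_gt0.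
Qed.

(** The digit count in base p, for the prime p below v and the single place v: elements distinct
    modulo v are distinct modulo p there, so there are at most p^n of them. *)
Lemma residue_bound v : exists C : nat, forall (T : finType) (y : T -> F),
  (forall t, vge v 0 (y t)) ->
  (forall t t', t != t' -> ~ vge v 1 (y t - y t')) -> (#|T| <= C)%N.
Proof.
have [p pp vp] := dval_prime v.
have [n [b [sg [gen _ _ embU]]]] := real_embedding_basis F_real.
exists (p ^ n)%N => T y yint ysep; rewrite -(ler_nat R) natrX.
have p0 := natF_neq0 F (prime_gt0 pp).
have e i : `|(sg i : {rmorphism F -> R}) p%:R| = p%:R by rewrite rmorph_nat normr_nat.
have := @digits_bound R F n b sg gen embU T y [set v] p%:R.
rewrite (eq_bigr _ (fun i _ => e i)) prodr_const card_ord; apply => //.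
- by exists 1%N, (fun=> p%:Z); rewrite big_ord1 expr0 mulr1 expr1.
- by move=> i; rewrite e ler_nat prime_gt1.
- by move=> w t ->.
- move=> t t' tt; exists v => // h; apply: (ysep _ _ tt).
  by apply: vgeW h; rewrite -gtz0_ge1.
- by move=> w ->; exact: ltW.
Qed.

Variable K : forall v : dvaluation F, completion v.
Local Notation rf v := (residue_field (cval (K v))).
Local Notation q v := (residue_card (cval (K v))).

(** Density of [F] in the completion puts an element of [F] in each residue class, which moves the
    count of residues down to [F]. *)
Lemma residue_rep v Z : rf v Z ->
  exists y, vge v 0 y /\ Z = [set z | vge (cval (K v)) 1 (z - cemb (K v) y)].
Proof.
move=> [x /= x0 <-]; have [y xy] := cdense (c := K v) 1 x; exists y; split.
  have : vge (cval (K v)) 0 (cemb (K v) y).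
    rewrite -(subKr x (cemb (K v) y)); apply: vgeD => //; apply: vgeN.
    exact: vgeW xy.
  have [->|y0] := eqVneq y 0; first by left.
  by move=> /vge_val; rewrite fmorph_eq0 => /(_ y0); rewrite cembE; right.
apply/seteqP; split=> z /= h.
  by rewrite -(subrK x z) -addrA; exact: vgeD.
by rewrite -(subrK (cemb (K v) y) z) -addrA; apply: vgeD => //; rewrite -opprB; exact: vgeN.
Qed.

Lemma vge_cemb v m y : vge (cval (K v)) m (cemb (K v) y) -> vge v m y.
Proof.
have [->|y0] := eqVneq y 0; first by left.
by move=> /vge_val; rewrite fmorph_eq0 => /(_ y0); rewrite cembE; right.
Qed.

Lemma residue_reps v (A : {fset (set (K v))}) : [set` A] `<=` rf v ->
  exists y : A -> F, [/\ forall t, vge v 0 (y t),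
    forall t, fsval t = [set z | vge (cval (K v)) 1 (z - cemb (K v) (y t))]
  & forall t t', t != t' -> ~ vge v 1 (y t - y t')].
Proof.
move=> Arf; have /choice[y hy] (t : A) : exists y, vge v 0 y /\
    fsval t = [set z | vge (cval (K v)) 1 (z - cemb (K v) y)].
  by apply: residue_rep; apply: Arf; exact: fsvalP.
exists y; split=> [t|t|t t' /eqP tt h]; [by case: (hy t)|by case: (hy t)|].
apply: tt; apply: val_inj => /=; have [_ ->] := hy t; have [_ ->] := hy t'.
have {}h : vge (cval (K v)) 1 (cemb (K v) (y t) - cemb (K v) (y t')).
  by rewrite -rmorphB; exact: vge_emb.
apply/seteqP; split=> z /= hz.
  by rewrite -(subrK (cemb (K v) (y t)) z) -addrA; exact: vgeD.
rewrite -(subrK (cemb (K v) (y t')) z) -addrA; apply: vgeD => //.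
by rewrite -opprB; exact: vgeN.
Qed.

(** This makes [residue_card] the true cardinality, since [fset_set] sends an infinite set to the
    empty one. *)
Lemma residue_field_finite v : finite_set (rf v).
Proof.
have [C hC] := residue_bound v.
apply: contrapT => /(infinite_set_fset C.+1)[A Arf cA].
have [y [yint _ ysep]] := residue_reps Arf.
by have := hC _ y yint ysep; rewrite -cardfE leqNgt cA.
Qed.

Definition residue_system (S : set (dvaluation F)) (e : dvaluation F -> nat)
    (T : finType) (r : T -> F) : Prop :=
  [/\ forall t v, S v -> vge v 0 (r t),
      forall t t', t != t' -> exists2 v, S v & ~ vge v (e v)%:Z (r t - r t')
    & forall y, (forall v, S v -> vge v 0 y) ->
        exists t, forall v, S v -> vge v (e v)%:Z (y - r t)].

Lemma residue_system1 v : exists (T : finType) (r : T -> F),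
  #|T| = q v /\ residue_system [set v] (fun=> 1%N) r.
Proof.
have Arf : [set` fset_set (rf v)] `<=` rf v.
  by rewrite fset_setK//; exact: residue_field_finite.
have [r [rint rE rsep]] := residue_reps Arf.
exists (fset_set (rf v)), r; split; first by rewrite -cardfE.
split; first by move=> t w ->.
- by move=> t t' tt; exists v => //; exact: rsep.
- move=> y /(_ _ erefl) vy.
  have Zin : [set z | vge (cval (K v)) 1 (z - cemb (K v) y)] \in fset_set (rf v).
    rewrite in_fset_set ?inE; last exact: residue_field_finite.
    by exists (cemb (K v) y) => //=; exact: vge_emb.
  exists [` Zin]%fset => _ ->; apply: vge_cemb; rewrite rmorphB.
  have := rE [` Zin]%fset => /= /seteqP[/(_ (cemb (K v) y)) /= h _].
  by apply: h; rewrite subrr; left.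
Qed.

Lemma residue_card_gt0 v : (0 < q v)%N.
Proof.
have [T [r [<- [_ _ /(_ 0)[|t _]]]]] := residue_system1 v; last by apply/card_gt0P; exists t.
by move=> w _; left.
Qed.

(** Expansion in a uniformiser [pi]: a representative modulo v^e plus pi^e times a representative
    modulo v. *)
Lemma residue_system_exp v (e : nat) : exists (T : finType) (r : T -> F),
  #|T| = (q v ^ e)%N /\ residue_system [set v] (fun=> e) r.
Proof.
have [T1 [r1 [c1 [r1int r1sep r1cov]]]] := residue_system1 v.
have [pi pi0 vpi] := dval_onto v.
elim: e => [|e [T [r [cT [rint rsep rcov]]]]].
  exists unit, (fun=> 0); rewrite card_unit expn0; split=> //; split.
  - by move=> *; left.
  - by case=> -[].
  - by move=> y hy; exists tt => w Sw; rewrite subr0; exact: hy.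
have vpe : v (pi ^+ e) = e%:Z by rewrite -[pi ^+ e]/(pi ^ e%:Z) dvalX// vpi mulr1.
have pe0 : pi ^+ e != 0 by rewrite expf_neq0.
exists (T * T1)%type, (fun p => r p.1 + pi ^+ e * r1 p.2).
rewrite card_prod cT c1 expnSr; split=> //.
have scal m y : vge v m y -> vge v (e%:Z + m) (pi ^+ e * y).
  by move=> h; apply: vgeM => //; right; rewrite vpe.
split.
- move=> t w ->; apply: vgeD; first exact: rint.
  by apply: (@vgeW _ _ (e%:Z + 0)); [rewrite addr0|apply: scal; exact: r1int].
- move=> [t i] [t' i'] ne; exists v => //= h.
  have dE : r t + pi ^+ e * r1 i - (r t' + pi ^+ e * r1 i') =
    (r t - r t') + pi ^+ e * (r1 i - r1 i') by ring.
  have di : vge v 0 (r1 i - r1 i') by apply: vgeD; [|apply: vgeN]; exact: r1int.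
  have tt : t = t'.
    apply/eqP/negPn/negP => /rsep[_ ->]; apply.
    rewrite -(addrK (pi ^+ e * (r1 i - r1 i')) (r t - r t')) -dE.
    apply: vgeD; first by apply: vgeW h; lia.
    by apply: vgeN; rewrite -[e%:Z]addr0; exact: scal.
  have ii : i != i' by apply: contraNneq ne => ->; rewrite tt.
  have [_ -> []] := r1sep _ _ ii.
  move: h; rewrite dE tt subrr add0r => h.
  rewrite -(mulKf pe0 (r1 i - r1 i')).
  apply: (@vgeW _ _ (- e%:Z + e.+1%:Z)); first by lia.
  by apply: vgeM => //; right; rewrite dvalV// vpe.
- move=> y hy; have [t /(_ v erefl) ht] := rcov y hy.
  have [i /(_ v erefl) hi] : exists i, forall w, [set v] w -> vge w 1 ((y - r t) / pi ^+ e - r1 i).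
    apply: r1cov => w ->; apply: (@vgeW _ _ (e%:Z - e%:Z)); first by rewrite subrr.
    by apply: vgeM => //; right; rewrite dvalV// vpe.
  exists (t, i) => w -> /=; have -> : y - (r t + pi ^+ e * r1 i) =
    pi ^+ e * ((y - r t) / pi ^+ e - r1 i) by field.
  by apply: vgeW (scal _ _ hi); lia.
Qed.

(** With M = N + 1, the quotient x^M/(1 + x^M) is close to 1 where x has a pole and close to 0 where
    x has a zero. *)
Lemma dval_idem_approx v (ws : seq (dvaluation F)) (N : nat) : v \notin ws ->
  exists u, vge v N%:Z (1 - u) /\ forall w, w \in ws -> vge w N%:Z u.
Proof.
move=> /dval_approx[x [x0 vx wx]].
have xN0 : x ^+ N.+1 != 0 by rewrite expf_neq0.
have vX w : w (x ^+ N.+1) = N.+1%:Z * w x by rewrite -[x ^+ N.+1]/(x ^ N.+1%:Z) dvalX.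
have [d0 vd] : 1 + x ^+ N.+1 != 0 /\ v (1 + x ^+ N.+1) = v (x ^+ N.+1).
  rewrite addrC; apply: dvalD_lt => //; right; rewrite dval1 vX.
  by move: vx; clear; nia.
exists (x ^+ N.+1 / (1 + x ^+ N.+1)); split.
  have -> : 1 - x ^+ N.+1 / (1 + x ^+ N.+1) = (1 + x ^+ N.+1)^-1 by field.
  by right; rewrite dvalV// vd vX; move: vx; clear; nia.
move=> w /wx wx0.
have [|_ wd] := @dvalD_lt _ w 1 (x ^+ N.+1) (oner_neq0 F).
  by right; rewrite dval1 vX; move: wx0; clear; nia.
right; rewrite dvalM ?invr_eq0// dvalV// wd dval1 vX.
by move: wx0; clear; nia.
Qed.

Lemma vge_bound (m : dvaluation F -> nat) (L : seq (dvaluation F * F)) :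
  exists N : nat, forall p, p \in L -> vge p.1 ((m p.1)%:Z - N%:Z) p.2.
Proof.
elim: L => [|[w x] L [N hN]]; first by exists 0%N.
exists (maxn N `|(m w)%:Z - w x|%N) => p; rewrite inE => /predU1P[->|/hN].
  by right; rewrite /=; lia.
by apply: vgeW; lia.
Qed.

(** The Chinese remainder theorem, by the interpolation u r1 + (1-u) r with u near 1 at v and near 0
    at the places of [S]. *)
Lemma residue_system_prod (S : seq (dvaluation F)) (e : dvaluation F -> nat) : uniq S ->
  exists (T : finType) (r : T -> F),
  #|T| = (\prod_(v <- S) q v ^ e v)%N /\ residue_system [set` S] e r.
Proof.
elim: S => [_|v S ih /= /andP[vS uS]].
  exists unit, (fun=> 0); rewrite card_unit big_nil; split=> //; split=> //.
have [T [r [cT [rint rsep rcov]]]] := ih uS.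
have [T1 [r1 [c1 [r1int r1sep r1cov]]]] := residue_system_exp v (e v).
(* [r1] is known to be integral only at v, and [r] only on [S]. The precision [N] is such that a
   factor of order N brings each of these finitely many differences to order at least [e w]. *)
have [N hN] := vge_bound e [seq (w, r1 p.1 - r p.2) | w <- v :: S, p <- enum {: T1 * T}].
have [u [uv uw]] := @dval_idem_approx v S N vS.
pose r' (p : T1 * T) := u * r1 p.1 + (1 - u) * r p.2.
have bd w p : w \in v :: S -> vge w ((e w)%:Z - N%:Z) (r1 p.1 - r p.2).
  by move=> wS; apply: (hN (w, _)); apply/allpairsP; exists (w, p); rewrite mem_enum.
have r'v p : vge v (e v)%:Z (r' p - r1 p.1).
  have -> : r' p - r1 p.1 = (1 - u) * - (r1 p.1 - r p.2) by rewrite /r'; ring.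
  apply: (@vgeW _ _ (N%:Z + ((e v)%:Z - N%:Z))); first by lia.
  by apply: vgeM => //; apply: vgeN; apply: bd; rewrite inE eqxx.
have r'w p w : w \in S -> vge w (e w)%:Z (r' p - r p.2).
  move=> wS; have -> : r' p - r p.2 = u * (r1 p.1 - r p.2) by rewrite /r'; ring.
  apply: (@vgeW _ _ (N%:Z + ((e w)%:Z - N%:Z))); first by lia.
  by apply: vgeM; [exact: uw|apply: bd; rewrite inE wS orbT].
have trans w m x y z : vge w m (x - y) -> vge w m (y - z) -> vge w m (x - z).
  by move=> h1 h2; rewrite -(subrK y x) -addrA; exact: vgeD.
have sym w m x y : vge w m (x - y) -> vge w m (y - x).
  by move=> h; rewrite -opprB; exact: vgeN.
exists (T1 * T)%type, r'; rewrite card_prod cT c1 big_cons; split=> //; split.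
- move=> p w /=; rewrite inE => /predU1P[->|wS].
    rewrite -(subrK (r1 p.1) (r' p)); apply: vgeD; last exact: r1int.
    by apply: vgeW (r'v p).
  rewrite -(subrK (r p.2) (r' p)); apply: vgeD; last exact: rint.
  by apply: vgeW (r'w p w wS).
- move=> p p' pp; have [ii|ii] := eqVneq p.1 p'.1; last first.
    exists v => [|h]; first by rewrite /= inE eqxx.
    have [_ -> []] := r1sep _ _ ii.
    exact: (trans _ _ _ _ _ (sym _ _ _ _ (r'v p)) (trans _ _ _ _ _ h (r'v p'))).
  have tt : p.2 != p'.2.
    by apply: contra pp => /eqP tt; rewrite [p]surjective_pairing [p']surjective_pairing ii tt.
  have [w wS nw] := rsep _ _ tt; exists w => [|h]; first by rewrite /= inE; apply/orP; right.
  apply: nw.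
  exact: (trans _ _ _ _ _ (sym _ _ _ _ (r'w p w wS)) (trans _ _ _ _ _ h (r'w p' w wS))).
- move=> y hy; have [i hi] : exists i, forall w, [set v] w -> vge w (e v)%:Z (y - r1 i).
    by apply: r1cov => w ->; apply: hy; rewrite /= inE eqxx.
  have [t ht] : exists t, forall w, [set` S] w -> vge w (e w)%:Z (y - r t).
    by apply: rcov => w wS; apply: hy; rewrite /= inE; apply/orP; right.
  exists (i, t) => w /=; rewrite inE => /predU1P[->|wS].
    exact: (trans _ _ _ _ _ (hi v erefl) (sym _ _ _ _ (r'v (i, t)))).
  exact: (trans _ _ _ _ _ (ht w wS) (sym _ _ _ _ (r'w (i, t) w wS))).
Qed.

End Residues.

(** * The product formula *)

Section ProductFormula.
Variables (R : realType) (F : fieldExtType rat).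
Hypothesis F_real : totally_real R F.
Variable K : forall v : dvaluation F, completion v.
Implicit Types (v w : dvaluation F) (x y : F).
Local Notation q v := (residue_card (cval (K v))).
Local Notation absv v := (vabs R (cval (K v))).

Lemma fsbig_setT_seq (I : choiceType) (f : I -> R) (S : seq I) : uniq S ->
  (forall i, i \notin S -> f i = 1) ->
  \big[*%R/1]_(i \in [set: I]) f i = \prod_(i <- S) f i.
Proof.
move=> uS hS; rewrite (fsbigE S)//; last by move=> i _; exact: hS.
by apply: eq_bigl => i; rewrite in_setT.
Qed.

(** Scaled by a common denominator d, the minimal polynomial has integer coefficients and leading
    coefficient d, so [valuation_ring_lead] applies at every place. *)
Lemma integer_multiple x : exists2 d, (0 < d)%N & forall v, vge v 0 (d%:R * x).
Proof.
have /choice[k kE] := minPoly_rat x.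
have [d d0 hd] := common_denominator (fun j : 'I_(size (minPoly 1 x)) => k j).
exists d => // v.
have d0' := natF_neq0 F d0.
have -> : d%:R = lead_coef (d%:R *: minPoly 1 x).
  by rewrite lead_coefZ (eqP (monic_minPoly 1 x)) mulr1.
apply: (valuation_ring_lead (dval_valuation_ring v)); last by rewrite rootZ// root_minPoly.
move=> i; rewrite coefZ; have [ilt|ige] := ltnP i (size (minPoly 1 x)); last first.
  by rewrite nth_default// mulr0; left.
have [z hz] := hd (Ordinal ilt); rewrite /= in hz; rewrite kE.
have -> : d%:R * (k i)%:A = z%:~R :> F.
  by rewrite -(rmorph_int (in_alg F)) -hz rmorphM rmorph_nat.
exact: vge_int.
Qed.

Lemma integral_basis : exists (n : nat) (b : 'I_n -> F) (sg : 'I_n -> real_place R F),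
  [/\ forall y, exists c : 'I_n -> rat, y = \sum_j (c j)%:A * b j,
      injective sg, forall s, exists i, s = sg i,
      (\matrix_(i, j) (sg i : {rmorphism F -> R}) (b j)) \in unitmx
    & forall j v, vge v 0 (b j)].
Proof.
have [n [b [sg [gen sgI sgS embU]]]] := real_embedding_basis F_real.
have [||d d0 hd] := @common_multiple 'I_n (fun j d => forall v, vge v 0 (d%:R * b j)).
- by move=> j; exact: integer_multiple.
- move=> j d m h v; rewrite natrM -mulrA -[0]addr0.
  by apply: vgeM; [exact: vge_nat|exact: h].
have d0' := natF_neq0 F d0.
exists n, (fun j => d%:R * b j), sg; split=> //.
- move=> y; have [c cE] := gen (y / d%:R); exists c.
  rewrite -(divfK d0' y) mulrC cE mulr_sumr; apply: eq_bigr => j _; exact: mulrCA.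
- have -> : \matrix_(i, j) (sg i : {rmorphism F -> R}) (d%:R * b j) =
     d%:R *: \matrix_(i, j) (sg i : {rmorphism F -> R}) (b j).
    by apply/matrixP => i j; rewrite !mxE rmorphM rmorph_nat.
  by rewrite unitmxZ// unitfE pnatr_eq0 -lt0n.
Qed.

Lemma residue_card_neq0 v : (q v)%:R != 0 :> R.
Proof. by rewrite pnatr_eq0 -lt0n (residue_card_gt0 F_real). Qed.

Lemma vabsM v (a b : K v) : absv v (a * b) = absv v a * absv v b.
Proof.
rewrite /vabs mulf_eq0; have [_|a0] /= := eqVneq a 0; first by rewrite mul0r.
have [_|b0] := eqVneq b 0; first by rewrite mulr0.
by rewrite dvalM// opprD expfzDr ?residue_card_neq0.
Qed.

Lemma vabs_unit v (a b : K v) : a * b = 1 ->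
  vge (cval (K v)) 0 a -> vge (cval (K v)) 0 b -> absv v a = 1.
Proof.
move=> ab ia ib; have a0 : a != 0.
  by apply/eqP => a0; move: ab; rewrite a0 mul0r => /eqP; rewrite eq_sym oner_eq0.
have b0 : b != 0.
  by apply/eqP => b0; move: ab; rewrite b0 mulr0 => /eqP; rewrite eq_sym oner_eq0.
have := dvalM (cval (K v)) a0 b0; rewrite ab dval1 /vabs (negbTE a0).
have := vge_val a0 ia; have := vge_val b0 ib => h1 h2 h3.
have -> : cval (K v) a = 0 by lia.
by rewrite oppr0 expr0z.
Qed.

(** Both t and t^-1 are integral at almost all places, which forces absolute value 1 there. The
    product over all finite places is thus a finite one, as multiplicativity of the norm
    requires. *)
Lemma idele_support (t : idele R K) : exists2 S : seq (dvaluation F), uniq S &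
  forall v, v \notin S -> absv v ((uval t).2 v) = 1.
Proof.
have fin : finite_set ([set v | ~ vge (cval (K v)) 0 ((uval t).2 v)] `|`
                       [set v | ~ vge (cval (K v)) 0 ((uinv t).2 v)]).
  by rewrite finite_setU; split; exact: fa_int.
exists (finmap.enum_fset (fset_set ([set v | ~ vge (cval (K v)) 0 ((uval t).2 v)] `|`
                       [set v | ~ vge (cval (K v)) 0 ((uinv t).2 v)]))).
  exact: finmap.fset_uniq.
move=> v; rewrite in_fset_set// notin_setE /= => /not_orP[/contrapT h1 /contrapT h2].
apply: vabs_unit h1 h2.
by have /(congr1 (fun a : adele R K => a.2 v)) := uvalV t.
Qed.

Lemma real_places_seq : exists2 S : seq (real_place R F), uniq S & forall s, s \in S.
Proof.
have [n [b [sg [_ sgI sgS _ _]]]] := integral_basis.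
exists (map sg (enum 'I_n)); first by rewrite map_inj_uniq ?enum_uniq.
by move=> s; have [i ->] := sgS s; apply: map_f; rewrite mem_enum.
Qed.

Lemma idelic_normM (t u : idele R K) :
  idelic_norm (unitM t u) = idelic_norm t * idelic_norm u.
Proof.
have [S uS tS] := idele_support t; have [S' uS' uuS'] := idele_support u.
have [P uP PP] := real_places_seq.
have uSS : uniq (undup (S ++ S')) by exact: undup_uniq.
have tS2 v : v \notin undup (S ++ S') -> absv v ((uval t).2 v) = 1.
  by rewrite mem_undup mem_cat negb_or => /andP[/tS].
have uS2 v : v \notin undup (S ++ S') -> absv v ((uval u).2 v) = 1.
  by rewrite mem_undup mem_cat negb_or => /andP[_ /uuS'].
rewrite /idelic_norm !(fsbig_setT_seq uP); try by move=> s; rewrite PP.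
rewrite !(fsbig_setT_seq uSS)//; last first.
  by move=> v vS /=; rewrite vabsM tS2// uS2// mulr1.
rewrite mulrACA -!big_split /=; congr (_ * _); apply: eq_bigr => i _.
  by rewrite -normrM.
by rewrite vabsM.
Qed.

Lemma principal_norm (n : nat) (sg : 'I_n -> real_place R F) (x : {x : F | x != 0})
    (S : seq (dvaluation F)) :
  injective sg -> (forall s, exists i, s = sg i) ->
  uniq S -> (forall v, v \notin S -> v (sval x) = 0) ->
  idelic_norm (principal R K x) =
    (\prod_i `|(sg i : {rmorphism F -> R}) (sval x)|) *
    \prod_(v <- S) (q v)%:R ^ (- v (sval x)).
Proof.
move=> sgI sgS uS hS; have x0 := svalP x.
have vE v : absv v (cemb (K v) (sval x)) = (q v)%:R ^ (- v (sval x)).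
  by rewrite /vabs fmorph_eq0 (negbTE x0) cembE.
rewrite /idelic_norm; congr (_ * _).
  have uP : uniq (map sg (enum 'I_n)) by rewrite map_inj_uniq ?enum_uniq.
  rewrite (fsbig_setT_seq uP); first by rewrite big_map big_enum.
  by move=> s /negP[]; have [i ->] := sgS s; apply: map_f; rewrite mem_enum.
rewrite (fsbig_setT_seq uS); first by apply: eq_bigr => v _; exact: vE.
by move=> v vS /=; rewrite vE hS// oppr0 expr0z.
Qed.

Lemma dval_support x : x != 0 -> exists2 S : seq (dvaluation F), uniq S &
  forall v, v \notin S -> v x = 0.
Proof.
move=> x0.
have fin : finite_set ([set v | ~ vge v 0 x] `|` [set v | ~ vge v 0 x^-1]).
  by rewrite finite_setU; split; exact: finite_nonintegral.
exists (finmap.enum_fset (fset_set ([set v | ~ vge v 0 x] `|` [set v | ~ vge v 0 x^-1]))).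
  exact: finmap.fset_uniq.
move=> v; rewrite in_fset_set// notin_setE /= => /not_orP[/contrapT h1 /contrapT h2].
have := vge_val x0 h1; have := vge_val _ h2; rewrite invr_eq0 x0 dvalV// => /(_ isT).
by lia.
Qed.

Local Notation nrm x := (idelic_norm (principal R K x)).
Implicit Types u : {x : F | x != 0}.

Lemma principal_norm_gt0 u : 0 < nrm u.
Proof.
have [n [b [sg [_ sgI sgS _ _]]]] := integral_basis.
have [S uS hS] := dval_support (svalP u).
rewrite (principal_norm sgI sgS uS hS) mulr_gt0//.
  by apply: prodr_gt0 => i _; rewrite normr_gt0 fmorph_eq0 (svalP u).
by apply: prodr_gt0 => v _; rewrite exprz_gt0// ltr0n (residue_card_gt0 F_real).
Qed.

Lemma principal_normM (u w z : {x : F | x != 0}) : sval z = sval u * sval w ->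
  nrm z = nrm u * nrm w.
Proof.
move=> e; rewrite -idelic_normM; congr idelic_norm; apply: units_inj.
by rewrite /= e rmorphM.
Qed.

(** [T] represents the residues modulo x, so its cardinality is the inverse of the finite part of
    the norm; [digits_bound] compares it with the archimedean part. *)
Lemma principal_norm_ge1_large u : (forall v, vge v 0 (sval u)) ->
  (forall s : real_place R F, 2 <= `|(s : {rmorphism F -> R}) (sval u)|) -> 1 <= nrm u.
Proof.
move=> uint u2; have u0 := svalP u.
have [n [b [sg [gen sgI sgS embU _]]]] := integral_basis.
have [S uS hS] := dval_support u0.
have [T [r [cT [rint rsep _]]]] := residue_system_prod F_real K (fun v => `|v (sval u)|%N) uS.
have uE v : (`|v (sval u)|%N)%:Z = v (sval u) by apply: gez0_abs; exact: vge_val (uint v).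
have := @digits_bound R F n b sg gen embU T r [set` S] (sval u).
have h : #|T|%:R * \prod_(v <- S) (q v)%:R ^ (- v (sval u)) = 1 :> R.
  rewrite cT natr_prod -big_split big1_seq//= => v _.
  by rewrite natrX -[X in X * _]/((q v)%:R ^ (`|v (sval u)|%N)%:Z) uE -expfzDr ?residue_card_neq0// subrr expr0z.
rewrite (principal_norm sgI sgS uS hS) => hd; rewrite -[leLHS]h.
apply: ler_wpM2r; first by apply: prodr_ge0 => v _; rewrite exprz_ge0.
apply: hd => //.
- exact: integral_of_vge.
- by move=> v t; exact: rint.
- move=> t t' /rsep[v vS hv]; exists v => //; by rewrite -uE.
- by move=> v _; exact: vge_val (uint v).
Qed.

Lemma principal_norm_nat_le1 (m : nat) u : (0 < m)%N -> sval u = m%:R -> nrm u <= 1.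
Proof.
move=> m0 um; have u0 := svalP u; rewrite um in u0.
have [n [b [sg [gen sgI sgS embU bint]]]] := integral_basis.
have [C C0 hC] := pigeonhole_bound gen embU bint.
have [S uS hS] := dval_support u0.
have v0 v : 0 <= v m%:R by apply: vge_val (vge_nat v m).
pose Q : R := \prod_(v <- S) (q v)%:R ^+ `|v m%:R|%N.
have Q0 : 0 < Q by apply: prodr_gt0 => v _; rewrite exprn_gt0// ltr0n (residue_card_gt0 F_real).
have QV : Q * \prod_(v <- S) (q v)%:R ^ (- v m%:R) = 1.
  rewrite -big_split big1_seq//= => v _.
  rewrite -[X in X * _]/((q v)%:R ^ (`|v m%:R|%N)%:Z) gez0_abs//.
  by rewrite -expfzDr ?residue_card_neq0// subrr expr0z.
have mQ : m%:R ^+ n <= Q.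
  (* The pigeonhole bound for m^k gives m^(nk) <= C Q^k with [C] independent of k. *)
  apply: (@exp_growth R _ _ C) => // k.
  have vk v : v (m ^ k)%:R = k%:Z * v m%:R.
    by rewrite natrX -[_ ^+ k]/(_ ^ k%:Z) dvalX.
  have [T [r [cT [rint rsep rcov]]]] :=
    residue_system_prod F_real K (fun v => (`|v m%:R| * k)%N) uS.
  have eE v : ((`|v m%:R| * k)%N)%:Z = v (m ^ k)%:R.
    by rewrite vk PoszM gez0_abs// mulrC.
  have [t0 _] : exists t, forall v, [set` S] v -> vge v (`|v m%:R| * k)%N%:Z (0 - r t).
    by apply: rcov => v _; left.
  (* The class map must be defined on all of [F]; where y is not integral on [S] any class will do,
     and [t0] provides one. *)
  have /choice[cls hcls] y : exists t, (forall v, [set` S] v -> vge v 0 y) ->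
      forall v, [set` S] v -> vge v (`|v m%:R| * k)%N%:Z (y - r t).
    have [h|h] := pselect (forall v, [set` S] v -> vge v 0 y).
      by have [t ht] := rcov y h; exists t.
    by exists t0.
  have := hC (m ^ k)%N T cls; rewrite expn_gt0 m0 => /(_ isT) {}hC.
  have -> : Q ^+ k = #|T|%:R.
    rewrite cT natr_prod -prodrXl; apply: eq_bigr => v _.
    by rewrite natrX exprM.
  rewrite -exprM mulnC exprM -natrX; apply: hC => y y' iy iy' cc v.
  have [vS|vS] := boolP (v \in S); last first.
    by rewrite vk hS// mulr0; apply: vgeD => //; exact: vgeN.
  rewrite -eE -(subrK (r (cls y)) y) -addrA; apply: vgeD.
    by apply: hcls => // w _; exact: iy.
  by rewrite cc -opprB; apply: vgeN; apply: hcls => // w _; exact: iy'.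
rewrite (principal_norm sgI sgS uS); last by move=> v; rewrite um; exact: hS.
rewrite um -[leRHS]QV; apply: ler_wpM2r.
  by apply: prodr_ge0 => v _; rewrite exprz_ge0.
rewrite (eq_bigr (fun=> m%:R)); first by rewrite prodr_const card_ord.
by move=> i _; rewrite rmorph_nat normr_nat.
Qed.

Lemma principal_norm_nat (m : nat) u : (1 < m)%N -> sval u = m%:R -> nrm u = 1.
Proof.
move=> m1 um; apply/eqP; rewrite eq_le (principal_norm_nat_le1 _ um) ?(ltnW m1)//=.
apply: principal_norm_ge1_large; first by move=> v; rewrite um; exact: vge_nat.
by move=> s; rewrite um rmorph_nat normr_nat ler_nat.
Qed.

(** Multiplication by the integer dM does not change the norm; d clears the denominators at all
    finite places and M makes every conjugate at least 2. *)
Lemma principal_norm_ge1 u : 1 <= nrm u.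
Proof.
have u0 := svalP u.
have [d d0 hd] := integer_multiple (sval u).
have [n [b [sg [_ sgI sgS _ _]]]] := integral_basis.
have [Y Y1 hY] := @finite_bound R 'I_n (fun i => 2 / `|(sg i : {rmorphism F -> R}) (sval u)|).
pose M := (Num.truncn Y).+2.
have MY : Y <= M%:R.
  have /andP[_ /ltW h] := truncn_itv (le_trans ler01 Y1).
  by apply: le_trans h _; rewrite ler_nat.
have dM1 : (1 < d * M)%N by rewrite /M; move: d0; clear; nia.
have dM0 := natF_neq0 F (ltnW dM1).
have z0 : (d * M)%:R * sval u != 0 by rewrite mulf_neq0.
have := @principal_normM (exist (fun x : F => x != 0) _ dM0) u (exist (fun x : F => x != 0) _ z0) erefl.
rewrite (@principal_norm_nat _ (exist (fun x : F => x != 0) _ dM0) dM1 erefl) mul1r => <-.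
apply: principal_norm_ge1_large => /= [v|s].
  rewrite mulnC natrM -mulrA -[0]addr0; apply: vgeM; [exact: vge_nat|exact: hd].
have [i ->] := sgS s; rewrite rmorphM normrM rmorph_nat normr_nat.
have s0 : 0 < `|(sg i : {rmorphism F -> R}) (sval u)| by rewrite normr_gt0 fmorph_eq0.
have := hY i; rewrite ler_pdivrMr// => /le_trans; apply; rewrite ler_pM2r//.
apply: le_trans MY _; rewrite ler_nat leq_pmull//.
Qed.

Lemma product_formula u : nrm u = 1.
Proof.
have uV0 : (sval u)^-1 != 0 by rewrite invr_eq0; exact: (svalP u).
pose uV : {x : F | x != 0} := exist (fun x : F => x != 0) _ uV0.
pose u1 : {x : F | x != 0} := exist (fun x : F => x != 0) 1 (oner_neq0 F).
have n1 : nrm u1 = 1.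
  have := @principal_normM u1 u1 u1; rewrite /= mulr1 => /(_ erefl) e.
  by apply: (mulIf (lt0r_neq0 (principal_norm_gt0 u1))); rewrite -e mul1r.
have := @principal_normM u uV u1; rewrite n1 mulfV ?(svalP u)// => /(_ erefl) e.
apply/eqP; rewrite eq_le principal_norm_ge1 andbT e.
by rewrite ler_peMr ?principal_norm_ge1// ltW// principal_norm_gt0.
Qed.

Lemma idelic_norm_gl2 (gamma : GL2 F) (g : GL2 (adele R K)) :
  idelic_norm (gdet (gmul (gmap (@diag R F K) gamma) g)) = idelic_norm (gdet g).
Proof.
have d0 : \det (gmx gamma) != 0.
  apply/eqP => d0; have := congr1 determinant (gmulmV gamma).
  by rewrite det_mulmx d0 mul0r det1 => /eqP; rewrite eq_sym oner_eq0.
have -> : gdet (gmul (gmap (@diag R F K) gamma) g) =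
    unitM (principal R K (exist (fun x : F => x != 0) _ d0)) (gdet g).
  by apply: units_inj; rewrite /= det_mulmx det_map_mx.
by rewrite idelic_normM product_formula mul1r.
Qed.

End ProductFormula.

(** * Invariance of the integral *)

Section ThetaInvariance.
Variables (R : realType) (F : fieldExtType rat).
Variable K : forall v : dvaluation F, completion v.

(** The positive and negative parts are summed separately, as families of nonnegative terms, and
    these can be permuted freely. *)
Lemma rsum_reindex (T : choiceType) (D : set T) (e : T -> T) (f : T -> R) :
  set_bij D D e -> rsum D (fun i => f (e i)) = rsum D f.
Proof.
move=> be; rewrite /rsum (reindex_esum D D e (fun i => (f^\+ i)%:E) be).
by rewrite (reindex_esum D D e (fun i => (f^\- i)%:E) be).
Qed.

Lemma csum_reindex (T : choiceType) (D : set T) (e : T -> T) (f : T -> R[i]) :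
  set_bij D D e -> csum D (fun i => f (e i)) = csum D f.
Proof.
move=> be; rewrite /csum (rsum_reindex (fun i => complex.Re (f i)) be).
by rewrite (rsum_reindex (fun i => complex.Im (f i)) be).
Qed.

Lemma gl2_bij (A : comPzRingType) (gamma : GL2 A) :
  set_bij [set v : 'cV[A]_2 | v != 0] [set v : 'cV[A]_2 | v != 0]
    (fun v => gmxV gamma *m v).
Proof.
have nz (M M' : 'M[A]_2) (v : 'cV[A]_2) : M' *m M = 1%:M -> v != 0 -> M *m v != 0.
  move=> MM; apply: contraNneq => e.
  by rewrite -(mul1mx v) -MM -mulmxA e mulmx0.
split.
- by move=> v /= v0; apply: nz (gmulmV gamma) v0.
- move=> v w _ _ e; rewrite -(mul1mx v) -(mul1mx w) -(gmulmV gamma) -!mulmxA.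
  by rewrite e.
- move=> v v0; exists (gmx gamma *m v); first exact: nz (gmulVm gamma) v0.
  by rewrite mulmxA gmulVm mul1mx.
Qed.

(** The scalar t^-1 commutes with gamma^-1, which therefore reaches the rational vector v. *)
Lemma gl2_scal_mul (A : comPzRingType) (B : comPzRingType) (f : {rmorphism A -> B})
    (t : units B) (gamma : GL2 A) (g : GL2 B) (v : 'cV[A]_2) :
  gmxV (gmul (gscal t) (gmul (gmap f gamma) g)) *m map_mx f v =
  gmxV (gmul (gscal t) g) *m map_mx f (gmxV gamma *m v).
Proof.
rewrite /= map_mxM -!mulmxA; congr (_ *m _).
by rewrite !mulmxA mul_mx_scalar mul_scalar_mx.
Qed.

Lemma csum_gl2 (A B : comPzRingType) (f : {rmorphism A -> B})
    (phi : 'cV[B]_2 -> R[i]) (t : units B) (gamma : GL2 A) (g : GL2 B) :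
  csum [set v : 'cV[A]_2 | v != 0] (fun v =>
    phi (gmxV (gmul (gscal t) (gmul (gmap f gamma) g)) *m map_mx f v)) =
  csum [set v : 'cV[A]_2 | v != 0] (fun v =>
    phi (gmxV (gmul (gscal t) g) *m map_mx f v)).
Proof.
rewrite -[RHS](csum_reindex _ (gl2_bij gamma)); congr csum.
by apply/funext => v; rewrite gl2_scal_mul.
Qed.

Lemma theta_gl2 (phi : 'cV[adele R K]_2 -> R[i]) (t : idele R K) (gamma : GL2 F)
    (g : GL2 (adele R K)) :
  theta phi (gmul (gscal t) (gmul (gmap (@diag R F K) gamma) g)) =
  theta phi (gmul (gscal t) g).
Proof. exact: csum_gl2. Qed.

End ThetaInvariance.

(** The product formula fixes the prefactor, and [theta_gl2] fixes the integrand at every class, so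
    the same function is integrated on both sides. *)
Lemma eisenstein_integral_gl2 (R : realType) (F : fieldExtType rat)
  (K : forall v : dvaluation F, completion v) (F_real : totally_real R F)
  (nu : {measure set (borel (idele_class R K)) -> \bar R})
  (omega : idele R K -> R[i]) (phi : 'cV[adele R K]_2 -> R[i])
  (gamma : GL2 F) (g : GL2 (adele R K)) (s : R[i]) :
  eisenstein_integral omega phi nu (gmul (gmap (@diag R F K) gamma) g) s =
  eisenstein_integral omega phi nu g s.
Proof.
have e := idelic_norm_gl2 F_real gamma g.
rewrite /eisenstein_integral e.
apply: (congr1 (fun f => _ * cintegral nu f)); apply/funext => q.
apply: (congr1 (fun z => _ * z)).
exact: theta_gl2.
Qed.

(** * Identity theorem for meromorphic functions *)

Section IdentityTheorem.
Variable R : realType.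
Local Notation C := (R[i]^o).
Implicit Types (c : nat -> C) (f g : C -> C) (a w z : C).

Lemma dnbhs_ex (a : C) (P : set C) : (\forall z \near a^', P z) -> exists z, P z.
Proof. exact: filter_ex. Qed.

Lemma half_geometric_sum k : \sum_(i < k) (2^-1 : C) ^+ i <= 2.
Proof.
suff -> : \sum_(i < k) (2^-1 : C) ^+ i = 2 - 2 * 2^-1 ^+ k.
  by rewrite gerBl mulr_ge0// exprn_ge0// invr_ge0.
elim: k => [|k ih]; first by rewrite big_ord0 expr0 mulr1 subrr.
rewrite big_ord_recr /= ih exprS; have : (2 : C) != 0 by rewrite pnatr_eq0.
by move: (2^-1 ^+ k) => q h; field.
Qed.

Lemma near_norm_lt a (d : C) : 0 < d -> \forall z \near a, `|z - a| < d.
Proof.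
move=> d0; apply: filterS (nbhsx_ballx a d d0) => z.
by rewrite -ball_normE /ball_ /= distrC.
Qed.

(** The hypotheses of the identity theorem for a power series at 0: convergence at a nonzero point,
    which bounds the terms, and nonzero zeros accumulating at the centre. *)
Definition clustering_zeros c : Prop :=
  (exists2 w : C, w != 0 & cvgn (series (fun n => c n * w ^+ n))) /\
  (forall d : C, 0 < d -> exists w : C, [/\ w != 0, `|w| < d &
     series (fun n => c n * w ^+ n) @ \oo --> (0 : C)]).

(** A nonzero c 0 would dominate near the centre: if [M] bounds the terms at w0, the remaining terms
    at w add up to at most 2Mt with t = |w|/|w0|. *)
Lemma clustering_zeros_coef0 c : clustering_zeros c -> c 0%N = 0.
Proof.
move=> [[w0 w00 cw0] hz]; apply/eqP/negPn/negP => c0.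
have [M M0 hM] : exists2 M : C, 0 < M & forall n, `|c n * w0 ^+ n| <= M.
  have /cvgr0_norm_lt/(_ 1 ltr01) [N _ hN] := cvg_series_cvg_0 cw0.
  exists (1 + \sum_(i < N) `|c i * w0 ^+ i|).
    by rewrite ltr_pwDl// sumr_ge0.
  move=> n; have [Nn|nN] := leqP N n.
    by apply: le_trans (ltW (hN n Nn)) _; rewrite lerDl sumr_ge0.
  rewrite (bigD1 (Ordinal nN))//= addrCA lerDl addr_ge0//.
  by rewrite sumr_ge0.
have nc0 : 0 < `|c 0%N| by rewrite normr_gt0.
have nw0 : 0 < `|w0| by rewrite normr_gt0.
(* Chosen so that |w| < d gives both t <= 1/2, for the geometric series, and 2Mt < |c 0|/2. *)
pose d := `|w0| / 2 * (`|c 0%N| / (`|c 0%N| + 4 * M)).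
have cM : 0 < `|c 0%N| + 4 * M by rewrite addr_gt0// mulr_gt0.
have d0 : 0 < d by rewrite !mulr_gt0 ?invr_gt0.
have [w [wn0 wd ws]] := hz d d0.
pose t := `|w| / `|w0|.
have t0 : 0 <= t by rewrite divr_ge0.
have tb : t < 2^-1 * (`|c 0%N| / (`|c 0%N| + 4 * M)).
  rewrite /t ltr_pdivrMr//; apply: lt_le_trans wd _.
  by rewrite /d le_eqVlt; apply/orP; left; apply/eqP; ring.
have th : t <= 2^-1.
  apply/ltW/(lt_le_trans tb); rewrite ler_piMr ?invr_ge0//.
  by rewrite ler_pdivrMr// mul1r lerDl mulr_ge0// ltW.
have tM : 2 * M * t < `|c 0%N| / 2.
  have M4 : 0 < 2 * M by rewrite mulr_gt0.
  apply: (@lt_le_trans _ _ (2 * M * (2^-1 * (`|c 0%N| / (`|c 0%N| + 4 * M))))).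
    by rewrite ltr_pM2l.
  have -> : 2 * M * (2^-1 * (`|c 0%N| / (`|c 0%N| + 4 * M))) =
     (`|c 0%N| / 2) * ((2 * M) / (`|c 0%N| + 4 * M)).
    by field; rewrite gt_eqF.
  rewrite ler_piMr ?divr_ge0// ler_pdivrMr// mul1r.
  apply: (@le_trans _ _ (4 * M)); last by rewrite lerDr.
  by rewrite ler_pM2r// ler_nat.
have c2 : 0 < `|c 0%N| / 2 by rewrite divr_gt0.
have /cvgr0_norm_lt/(_ _ c2) [k _ /(_ k.+1 (leqnSn k))] := ws.
rewrite /= seriesEord /= big_ord_recl expr0 mulr1 => hk.
have rest : `|\sum_(i < k) c (lift ord0 i) * w ^+ lift ord0 i| <= 2 * M * t.
  apply: le_trans (ler_norm_sum _ _ _) _.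
  apply: (@le_trans _ _ (\sum_(i < k) M * t * 2^-1 ^+ i)); last first.
    have -> : 2 * M * t = M * t * 2 by ring.
    by rewrite -mulr_sumr ler_wpM2l ?mulr_ge0 ?(ltW M0)// half_geometric_sum.
  apply: ler_sum => i _; rewrite lift0.
  have -> : `|c i.+1 * w ^+ i.+1| = `|c i.+1 * w0 ^+ i.+1| * (t * t ^+ i).
    rewrite -exprS /t expr_div_n !normrM !normrX; field.
    by rewrite expf_neq0 ?normr_eq0.
  rewrite -mulrA; apply: ler_pM => //; first by rewrite mulr_ge0// exprn_ge0.
  by rewrite ler_wpM2l// lerXn2r// nnegrE ?invr_ge0.
have : `|c 0%N| < `|c 0%N|; last by rewrite ltxx.
rewrite {2}(_ : `|c 0%N| = `|c 0%N| / 2 + `|c 0%N| / 2); last by field.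
rewrite -{1}(addrK (\sum_(i < k) c (lift ord0 i) * w ^+ lift ord0 i) (c 0%N)).
apply: le_lt_trans (ler_normB _ _) _; apply: ltrD => //.
exact: le_lt_trans rest tM.
Qed.

Lemma series_shift c w n : c 0%N = 0 ->
  series (fun n => c n * w ^+ n) n.+1 = w * series (fun n => c n.+1 * w ^+ n) n.
Proof.
move=> c0; rewrite !seriesEord /= big_ord_recl c0 mul0r add0r mulr_sumr.
by apply: eq_bigr => i _; rewrite lift0 exprS mulrCA.
Qed.

Lemma cvg_series_shift c w (l : C) : c 0%N = 0 -> w != 0 ->
  series (fun n => c n * w ^+ n) @ \oo --> w * l <->
  series (fun n => c n.+1 * w ^+ n) @ \oo --> l.
Proof.
move=> c0 w0; rewrite -cvg_shiftS.
have -> : [sequence series (fun n => c n * w ^+ n) n.+1]_n =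
          (fun n => w * series (fun n => c n.+1 * w ^+ n) n).
  by apply/funext => n; exact: series_shift.
split=> h; last exact: cvgMl_tmp.
rewrite -(mulKf w0 l).
have -> : series (fun n => c n.+1 * w ^+ n) =
   (fun n => w^-1 * (w * series (fun n => c n.+1 * w ^+ n) n)).
  by apply/funext => n; rewrite mulKf.
exact: cvgMl_tmp.
Qed.

(** Once c 0 = 0, the series can be divided by w and keeps its clustering zeros, so the coefficients
    vanish one after another. *)
Lemma clustering_zeros_eq0 c : clustering_zeros c -> forall n, c n = 0.
Proof.
move=> h n; elim: n c h => [|n ih] c h; first exact: clustering_zeros_coef0.
have c0 := clustering_zeros_coef0 h; have [[w w0 cw] hz] := h.
apply: (ih (fun n => c n.+1)); split.
  exists w; first exact: w0.
  have [l cl] := (cvg_ex _).1 cw; apply/cvg_ex; exists (w^-1 * l).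
  by apply/(cvg_series_shift _ c0 w0); rewrite mulVKf.
move=> d d0; have [z [z0 zd zs]] := hz d d0; exists z; split; [exact: z0|exact: zd|].
by apply/(cvg_series_shift _ c0 z0); rewrite mulr0.
Qed.

Definition expansion_at f a (k : nat) c : Prop := \forall z \near a^',
  series (fun n => c n * (z - a) ^+ n) @ \oo --> (z - a) ^+ k * f z.

Lemma dnbhs_neq a : \forall z \near a^', z != a.
Proof. exact: withinT. Qed.

(** Multiplication by (z-a)^j shifts the coefficients; it serves to give two functions the same
    exponent k. *)
Lemma expansion_at_pad f a k j c : expansion_at f a k c ->
  exists c', expansion_at f a (j + k) c'.
Proof.
elim: j c => [|j ih] c h; first by exists c.
have [c' hc'] := ih c h; exists (fun n => if n is m.+1 then c' m else 0).
have an := dnbhs_neq a; rewrite /expansion_at; near=> z.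
have za : z - a != 0 by rewrite subr_eq0; near: z.
rewrite addSn exprS -mulrA.
apply/(@cvg_series_shift (fun n => if n is m.+1 then c' m else 0) _ _ erefl za).
by near: z.
Unshelve. all: by end_near. Qed.

(** Unless f and g differ throughout a punctured neighbourhood, the zeros of the difference of the
    two series cluster at a, so its coefficients vanish; the factor (z-a)^k is nonzero off a. *)
Lemma expansion_at_eq f g a k c c' : expansion_at f a k c -> expansion_at g a k c' ->
  ~ (\forall z \near a^', f z != g z) -> \forall z \near a^', f z = g z.
Proof.
move=> fc gc fg.
have hs : expansion_at (fun z => f z - g z) a k (fun n => c n - c' n).
  apply: filterS2 fc gc => z h1 h2.
  have -> : series (fun n => (c n - c' n) * (z - a) ^+ n) =
    (fun n => series (fun n => c n * (z - a) ^+ n) n - series (fun n => c' n * (z - a) ^+ n) n).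
    apply/funext => n; rewrite !seriesEord /= -sumrB.
    by apply: eq_bigr => i _; rewrite mulrBl.
  have -> : (z - a) ^+ k * (f z - g z) = (z - a) ^+ k * f z - (z - a) ^+ k * g z.
    exact: mulrBr.
  exact: (cvgB h1 h2).
have c0 : forall n, c n - c' n = 0.
  apply: (@clustering_zeros_eq0 (fun n => c n - c' n)); split.
    have [z [za hz]] := dnbhs_ex (filterI (dnbhs_neq a) hs).
    exists (z - a); first by rewrite subr_eq0.
    by apply/cvg_ex; exists ((z - a) ^+ k * (f z - g z)).
  move=> d d0; apply: contrapT => nex; apply: fg.
  have nd : \forall z \near a^', `|z - a| < d.
    by apply: nbhs_dnbhs; exact: near_norm_lt.
  have an := dnbhs_neq a; near=> z; apply/negP => /eqP e; apply: nex; exists (z - a); split.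
  - by rewrite subr_eq0; near: z.
  - by near: z.
  - have : series (fun n => (c n - c' n) * (z - a) ^+ n) @ \oo --> (z - a) ^+ k * (f z - g z) by near: z.
    by rewrite e subrr mulr0.
have an := dnbhs_neq a; near=> z.
have za : z - a != 0 by rewrite subr_eq0; near: z.
have : series (fun n => (c n - c' n) * (z - a) ^+ n) @ \oo --> (z - a) ^+ k * (f z - g z) by near: z.
have -> : series (fun n => (c n - c' n) * (z - a) ^+ n) = (fun=> 0).
  by apply/funext => n; rewrite seriesEord /= big1// => i _; rewrite c0 mul0r.
move=> h; have /eqP : (z - a) ^+ k * (f z - g z) = 0.
  apply: (cvg_unique (@norm_hausdorff _ C) h); exact: cvg_cst.
by rewrite mulf_eq0 expf_eq0 (negbTE za) andbF /= subr_eq0 => /eqP.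
Unshelve. all: by end_near. Qed.

Lemma meromorphic_at_eq f g a : meromorphic_at f a -> meromorphic_at g a ->
  ~ (\forall z \near a^', f z != g z) -> \forall z \near a^', f z = g z.
Proof.
move=> [k [c fc]] [l [d gd]].
have [c' fc'] := expansion_at_pad l fc; have [d' gd'] := expansion_at_pad k gd.
by apply: expansion_at_eq fc' _; rewrite addnC; exact: gd'.
Qed.

(** At b = a this is the hypothesis; a point b != a has a neighbourhood that avoids a. *)
Lemma near_dnbhs_near a (P : set C) : (\forall z \near a^', P z) ->
  \forall b \near a, \forall z \near b^', P z.
Proof.
move=> h; have /nbhs_interior hn : \forall z \near a, z != a -> P z by exact: h.
near=> b; have [->//|ba] := eqVneq b a.
have hb : \forall z \near b, z != a -> P z by near: b.
have nb : nbhs b (~` [set a]).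
  apply: open_nbhs_nbhs; split; last exact/eqP.
  apply: closed_openC; apply: accessible_closed_set1; apply: hausdorff_accessible.
  exact: (@norm_hausdorff _ C).
by apply: nbhs_dnbhs; apply: filterS2 hb nb => z hz za; apply: hz; exact/eqP.
Unshelve. all: by end_near. Qed.

(** The segment starts at 2, an interior point of the half-plane Re s > 1 on which the two functions
    agree. *)
Lemma path_from_two a : exists p : R -> C, [/\ p 0 = 2, p 1 = a
  & forall t (P : set C), nbhs (p t) P -> nbhs t (p @^-1` P)].
Proof.
exists (fun t => 2 + (t%:C)%C * (a - 2)); split.
- by rewrite rmorph0 mul0r addr0.
- by rewrite rmorph1 mul1r addrC subrK.
move=> t; suff : (fun t => 2 + (t%:C)%C * (a - 2) : C) @ t --> (2 + (t%:C)%C * (a - 2) : C) by [].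
apply: cvgD; first exact: cvg_cst.
apply: cvgM; last exact: cvg_cst.
apply/cvgrPdist_lt => e e0.
have [er eE] : 0 < complex.Re e /\ e = ((complex.Re e)%:C)%C.
  by move: e0; case: e => x y; rewrite ltcE /= => /andP[/eqP -> ->].
apply: filterS (nbhsx_ballx t _ er) => u; rewrite -ball_normE /ball_ /= => h.
by rewrite -rmorphB normc_def /= expr0n addr0 sqrtr_sqr eE ltcR.
Qed.

Lemma near_two : \forall z \near (2 : C), 1 < complex.Re z.
Proof.
apply: filterS (near_norm_lt 2 ltr01) => z z1.
have : `|complex.Re (z - 2)| < 1.
  by rewrite -ltcR; apply: le_lt_trans (normc_ge_Re _) z1.
rewrite ltr_norml => /andP[h _]; move: h.
rewrite (_ : complex.Re (z - 2) = complex.Re z - 2); first by lra.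
by case: z z1 => x y _; rewrite -[2](rmorph_nat (real_complex R) 2).
Qed.

(* Joining a to 2 by a line reduces connectedness of the plane to that of R. *)
Lemma meromorphic_identity f g : meromorphic f -> meromorphic g ->
  (forall s, 1 < complex.Re s -> f s = g s) -> meromorphic_eq f g.
Proof.
move=> mf mg fg a; have [p [p0 p1 pc]] := path_from_two a.
pose A := [set t : R | \forall z \near (p t)^', f z = g z].
have A0 : A 0.
  by rewrite /A /= p0; apply: nbhs_dnbhs; apply: filterS near_two => z; exact: fg.
have oA : open A.
  by rewrite openE => t /near_dnbhs_near h; exact: (pc t _ h).
(* Otherwise f and g differ on a punctured neighbourhood of p t, hence near p u for some u in [A]
   close to t, where they agree. *)
have cA : closed A.
  move=> t tA; apply: meromorphic_at_eq; [exact: mf|exact: mg|move=> h].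
  have [u [Au hu]] := tA _ (pc t _ (near_dnbhs_near h)).
  have [z [zE]] := dnbhs_ex (filterI Au hu).
  by rewrite zE eqxx.
have cR : connected [set: R] by apply/connected_intervalP.
have AT : A = setT.
  apply: cR; first by exists 0.
    by exists A => //; rewrite setTI.
  by exists A => //; rewrite setTI.
have : A 1 by rewrite AT.
by rewrite /A /= p1.
Qed.

End IdentityTheorem.

Theorem mainTheorem4 (R : realType) (F : fieldExtType rat)
  (K : forall v : dvaluation F, completion v)
  (F_real : totally_real R F)
  (mu : {measure set (borel (idele R K)) -> \bar R})
  (mu_haar : is_haar mu)
  (nu : {measure set (borel (idele_class R K)) -> \bar R})
  (nu_quotient : is_quotient_measure mu nu)
  (omega : idele R K -> R[i])
  (omega_hecke : unitary_hecke_character omega)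
  (phi : 'cV[adele R K]_2 -> R[i])
  (phi_SB : schwartz_bruhat phi)
  (gamma : GL2 F) (g : GL2 (adele R K)) :
  (forall s : R[i], 1 < complex.Re s ->
     eisenstein_integral omega phi nu (gmul (gmap (@diag R F K) gamma) g) s =
     eisenstein_integral omega phi nu g s) /\
  (forall E1 E2 : R[i] -> R[i],
     is_eisenstein omega phi nu (gmul (gmap (@diag R F K) gamma) g) E1 ->
     is_eisenstein omega phi nu g E2 ->
     meromorphic_eq E1 E2).
Proof.
have e s := eisenstein_integral_gl2 F_real nu omega phi gamma g s.
split=> [s _|E1 E2 [m1 E1E] [m2 E2E]]; first exact: e.
apply: meromorphic_identity m1 m2 _ => s s1.
exact: etrans (E1E s s1) (etrans (e s) (esym (E2E s s1))).
Qed.
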